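(* Let $\mathbb{F}_q$ be a finite field of characteristic $3$ and let $\mathcal{F}=\mathbb{F}_q(x,y)$ be a cubic function field given in standard form by $y^3-Ay+B=0$ with $A,B\in\mathbb{F}_q[x]$. Let $n_1=\deg(A)$, $n_0=\deg(B)$, and let $a$, $b$ be the leading coefficients of $A$, $B$. Then the signature of $\mathcal{F}/\mathbb{F}_q(x)$ at the infinite place $P_\infty$ is: \begin{itemize} \item $(1,1,1,1,1,1)$ if $3n_1>2n_0$, $n_1$ is even and $a$ is a square in $\mathbb{F}_q$; or if $3n_1=2n_0$ and $T^3-aT+b=0$ has three roots in $\mathbb{F}_q$. \item $(1,1,2,1)$ if $3n_1>2n_0$ and $n_1$ is odd. \item $(1,1,1,2)$ if $3n_1>2n_0$, $n_1$ is even and $a$ is not a square in $\mathbb{F}_q$; or if $3n_1=2n_0$ and $T^3-aT+b$ has one root in $\mathbb{F}_q$. \item $(3,1)$ if $3n_1<2n_0$ and $n_0\not\equiv 0\pmod 3$. \item $(1,3)$ if $3n_1=2n_0$ and $T^3-aT+b$ has no roots in $\mathbb{F}_q$. \end{itemize} (No assertion is made in the case $3n_1<2n_0$ with $n_0\equiv 0\pmod 3$.)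
   Context: Cubic function field in standard form: $\mathcal{F}=\mathbb{F}_q(x,y)$ where $x$ is transcendental over $\mathbb{F}_q$, $T^3-A(x)T+B(x)\in\mathbb{F}_q[x][T]$ is irreducible over $\mathbb{F}_q(x)$ with root $y$, at least one of $A,B$ is non-constant, there is no non-constant $Q\in\mathbb{F}_q[x]$ with $Q^2\mid A$ and $Q^3\mid B$, and $\mathbb{F}_q$ is algebraically closed in $\mathcal{F}$. Convention: $\deg(0)=-\infty$. The infinite place $P_\infty$ of $\mathbb{F}_q(x)$ is the one with valuation $v_{P_\infty}(G)=-\deg(G)$ for polynomials $G$. The signature of $\mathcal{F}/\mathbb{F}_q(x)$ at a place $P$ of $\mathbb{F}_q(x)$ is the list of pairs $(e(P_i|P),f(P_i|P))$ of ramification indices and relative (residue) degrees of all places $P_1,\dots,P_m$ of $\mathcal{F}$ above $P$, written as one tuple and ordered lexicographically; e.g. $(1,1,2,1)$ means two places, one with $e=f=1$ and one with $e=2$, $f=1$. *)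

(* Defs.v *)
From HB Require Import structures.
From mathcomp Require Import all_boot all_order all_algebra all_field.
From mathcomp Require Import generic_quotient mathcomp_extra constructive_ereal.

Set Implicit Arguments.
Unset Strict Implicit.
Unset Printing Implicit Defensive.

Import Order.TTheory GRing.Theory Num.Theory.
Local Open Scope ring_scope.

Notation "x %:F" := (@FracField.tofrac _ x) : ring_scope.

(** * Places *)

(* A place is represented by its normalized discrete valuation v; its
   valuation ring is {z | 0 <= v z} and the place itself, the maximal ideal,
   is {z | 0 < v z}.  The axioms force v to be finite on nonzero elements and
   to map them onto the integers.  Triviality on a finite constant field is
   automatic, since its nonzero elements are roots of unity. *)
Record place (E : fieldType) := Place {
  val_of :> E -> \bar int;
  val_of_eqy : forall z, (val_of z == +oo)%E = (z == 0);
  val_ofM : forall z w, val_of (z * w) = (val_of z + val_of w)%E;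
  val_ofD : forall z w, (Order.min (val_of z) (val_of w) <= val_of (z + w)%R)%E;
  val_of_normal : exists t, val_of t = 1%E
}.

Section Signature.
Variables (K : fieldType) (L : fieldExtType K).
Implicit Types (P : place K) (Q : place L).

Definition lies_above Q P : Prop :=
  forall z : K, (0 < P z)%E -> (0 < Q z%:A)%E.

Definition ramification_index Q P (e : nat) : Prop :=
  forall z : K, Q z%:A = (e%:Z%:E * P z)%E.

(* The residue field of Q has dimension f over the residue field of P:
   the classes of b_0, ..., b_(f-1) form a basis. *)
Definition residue_degree Q P (f : nat) : Prop :=
  exists b : 'I_f -> L,
  [/\ forall i, (0 <= Q (b i))%E,
      forall z : L, (0 <= Q z)%E ->
        exists2 c : 'I_f -> K, (forall i, (0 <= P (c i))%E)
                             & (0 < Q (z - \sum_i c i *: b i)%R)%E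
    & forall c : 'I_f -> K, (forall i, (0 <= P (c i))%E) ->
        (0 < Q (\sum_i c i *: b i)%R)%E -> forall i, (0 < P (c i))%E].

(* s is the flattened, lexicographically ordered list of the pairs (e, f) of
   the places Q_0, ..., Q_(m-1) of L above P, each listed exactly once. *)
Definition signature P (s : seq nat) : Prop :=
  exists (m : nat) (Q : 'I_m -> place L) (e f : 'I_m -> nat),
  let ef := [seq (e i, f i) : nat *l nat | i <- enum 'I_m] in
  [/\ (forall i j, Q i =1 Q j -> i = j) /\
      (forall Q', lies_above Q' P <-> exists i, Q' =1 Q i),
      forall i, ramification_index (Q i) P (e i),
      forall i, residue_degree (Q i) P (f i),
      sorted <=%O ef
    & s = flatten [seq [:: p.1; p.2] | p <- ef]].

End Signature.

(** * Degrees and the infinite place of F(x) *)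

Section InfinitePlace.
Variable F : fieldType.
Implicit Types (p : {poly F}) (g : {fraction {poly F}}).

Definition deg p : \bar int :=
  if p == 0 then (-oo)%E else ((size p).-1)%:Z%:E.

Definition vinf g : \bar int := (deg \d_(repr g) - deg \n_(repr g))%E.

Lemma deg_eqNy p : (deg p == -oo%E) = (p == 0).
Proof. by rewrite /deg; case: (p == 0). Qed.

Lemma degE p : p != 0 -> deg p = ((size p).-1)%:Z%:E.
Proof. by rewrite /deg => /negPf->. Qed.

Lemma deg_neqy p : deg p != +oo%E.
Proof. by rewrite /deg; case: (p == 0). Qed.

Lemma degM p q : deg (p * q) = (deg p + deg q)%E.
Proof.
have [->|p0] := eqVneq p 0; first by rewrite mul0r /deg eqxx.
have [->|q0] := eqVneq q 0; first by rewrite mulr0 /deg eqxx; case: (p == 0).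
rewrite !degE ?mulf_neq0 // -EFinD -PoszD size_mul //; congr (_%:Z%:E).
move: p0 q0; rewrite -!size_poly_gt0.
by case: (size p) => // a; case: (size q) => // b _ _; rewrite addnS addSn.
Qed.

Lemma degD p q : (deg (p + q)%R <= Order.max (deg p) (deg q))%E.
Proof.
have [->|pq0] := eqVneq (p + q) 0; first by rewrite /deg eqxx leNye.
have [p0|p0] := eqVneq p 0.
  by rewrite p0 add0r le_max lexx orbT.
have [q0|q0] := eqVneq q 0.
  by rewrite q0 addr0 le_max lexx.
rewrite !degE // le_max !lee_fin !lez_nat.
have := size_polyD p q; rewrite leq_max => /orP[] h; apply/orP; [left|right];
  by rewrite -!subn1 leq_sub2r.
Qed.

Lemma frac_repr g : g = (\n_(repr g))%:F / (\d_(repr g))%:F.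
Proof.
rewrite -[g in LHS]reprK; move: (repr g) => r; have r0 := denom_ratioP r.
rewrite -[RHS]/(FracField.mul _ (FracField.inv _)) !piE.
rewrite /FracField.mulf /FracField.invf !numden_Ratio ?oner_neq0 //.
by rewrite mul1r mulr1 FracField.Ratio_numden.
Qed.

Lemma vinf_frac n d : d != 0 -> vinf (n%:F / d%:F) = (deg d - deg n)%E.
Proof.
move=> d0; rewrite /vinf; set g := n%:F / d%:F.
have e0 := denom_ratioP (repr g).
have : n * \d_(repr g) = \n_(repr g) * d.
  apply/eqP; rewrite -tofrac_eq !tofracM; apply/eqP.
  have := frac_repr g; rewrite {1}/g => /eqP.
  by rewrite GRing.eqr_div ?tofrac_eq0 // => /eqP.
move: (\n_(repr g)) (\d_(repr g)) e0 => a b b0 /(congr1 deg).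
rewrite !degM !(degE b0) !(degE d0).
move: (deg_neqy n) (deg_neqy a); case: (deg n) (deg a) => [x||] [y||] //= _ _.
move=> [h]; congr (_%:E); apply/eqP; rewrite subr_eq.
by rewrite addrAC eq_sym subr_eq [_ + x]addrC h addrC.
Qed.

Lemma vinf_poly p : vinf p%:F = (- deg p)%E.
Proof.
rewrite -[p%:F]divr1 -tofrac1 vinf_frac ?oner_neq0 // degE ?oner_neq0 //.
by rewrite size_poly1 add0e.
Qed.

Lemma vinf_eqy g : (vinf g == +oo)%E = (g == 0).
Proof.
have d0 := denom_ratioP (repr g).
rewrite [g in RHS]frac_repr mulf_eq0 invr_eq0 !tofrac_eq0 (negPf d0) orbF.
rewrite /vinf (degE d0) -deg_eqNy.
by move: (deg_neqy \n_(repr g)); case: (deg _).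
Qed.

Lemma vinfM g h : vinf (g * h) = (vinf g + vinf h)%E.
Proof.
have d0 := denom_ratioP (repr g); have e0 := denom_ratioP (repr h).
rewrite [g in LHS]frac_repr [h in LHS]frac_repr mulf_div -!tofracM.
rewrite vinf_frac ?mulf_neq0 // !degM /vinf !(degE d0) !(degE e0).
move: (deg_neqy \n_(repr g)) (deg_neqy \n_(repr h)).
case: (deg _) => [x||] //; case: (deg _) => [y||] //= _ _.
by congr (_%:E); rewrite opprD addrACA.
Qed.

Lemma vinfD g h : (Order.min (vinf g) (vinf h) <= vinf (g + h)%R)%E.
Proof.
have d0 := denom_ratioP (repr g); have e0 := denom_ratioP (repr h).
have key (b c m : int) (n s : \bar int) : m = b + c -> n != +oo%E -> s != +oo%E ->
    (s <= n + c%:E)%E -> (b%:E - n <= m%:E - s)%E.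
  move=> ->; case: n => [x||]; case: s => [z||] //= _ _; rewrite ?leey // !lee_fin.
  by move=> zxc; rewrite -addrA lerD2l lerBrDl lerBlDr addrC.
rewrite [g in leRHS]frac_repr [h in leRHS]frac_repr.
rewrite addf_div ?tofrac_eq0 // -!tofracM -tofracD vinf_frac ?mulf_neq0 //.
have := degD (\n_(repr g) * \d_(repr h)) (\n_(repr h) * \d_(repr g)).
rewrite !degM le_max ge_min /vinf !(degE d0) !(degE e0) -EFinD.
case/orP=> hdeg; apply/orP; [left|right].
  by apply: (key _ _ _ _ _ erefl _ _ hdeg); apply: deg_neqy.
by apply: (key _ _ _ _ _ (addrC _ _) _ _ hdeg); apply: deg_neqy.
Qed.

Lemma vinf_normal : exists g, vinf g = 1%E.
Proof.
exists (1%:F / 'X%:F); rewrite vinf_frac ?polyX_eq0 //.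
by rewrite !degE ?polyX_eq0 ?oner_neq0 // size_polyX size_poly1.
Qed.

Definition P_infty : place {fraction {poly F}} :=
  Place vinf_eqy vinfM vinfD vinf_normal.

End InfinitePlace.

(** * Cubic function fields in standard form *)

Definition cubic (R : nzRingType) (a b : R) : {poly R} :=
  'X^3 - a *: 'X + b%:P.

(* The field L is an extension of the field of rational functions, so that
   the element x is 'X%:F, which is transcendental over F. *)
Record standard_form (F : finFieldType) (L : fieldExtType {fraction {poly F}})
    (A B : {poly F}) (y : L) : Prop := StandardForm {
  sf_irreducible : irreducible_poly (cubic A%:F B%:F);
  sf_root : y ^+ 3 - A%:F%:A * y + B%:F%:A = 0;
  sf_generated : <<1%VS; y>>%VS = fullv;
  sf_nonconstant : (1 < size A)%N || (1 < size B)%N;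
  sf_reduced : forall Q : {poly F},
    Q ^+ 2 %| A -> Q ^+ 3 %| B -> (size Q <= 1)%N;
  sf_constants : forall z : L,
    algebraicOver (fun c : F => c%:P%:F%:A) z -> exists c : F, z = c%:P%:F%:A
}.

(* Main.v *)
Require Import Defs.
From mathcomp Require Import all_boot all_order all_algebra all_field.
From mathcomp Require Import constructive_ereal.
From mathcomp Require Import zify ring.
From mathcomp Require boolp classical_sets.
Import Order.TTheory.
Import GRing.Theory Num.Theory.
Local Open Scope ring_scope.

Set Implicit Arguments.
Unset Strict Implicit.
Unset Printing Implicit Defensive.

(** The proof separates the existence of places from their enumeration.

    Enumeration rests on the fundamental inequality: the sum of the e_i f_i
    over distinct places above P is at most the degree 3. Hence it suffices to
    exhibit distinct places with lower bounds e_i for the ramification indices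
    and f_i for the residue degrees such that the e_i f_i add up to 3: there
    are then no other places and the bounds are exact
    (signature_of_lower_bounds). The inequality comes from weak approximation:
    families of elements, one for each place and independent modulo P there,
    can be made close to 0 at all the other places, and their union is then
    linearly independent over K (free_mod_card).

    Existence comes from Chevalley's theorem: a proper ideal in a subring of L
    containing the valuation ring O of P stays proper in some valuation ring
    of L (chevalley), and a valuation ring of a finite extension that lies over
    O is discrete, since bounded powers of elements of L agree with elements of
    K up to units (place_of_valuation_ring). Applied to O + O s + O s^2 for an
    integral s whose norm has positive valuation, this gives a place where s
    vanishes (cubic_place).

    The cases follow by choosing s. If 3 deg A > 2 deg B, then w = y^2 / A
    satisfies w (w - 1)^2 = B^2 / A^3, which vanishes at infinity, so there is
    a place where w = 0 and another one where w = 1. At the latter y behaves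
    like a square root of A: it is ramified when deg A is odd, has residue
    degree 2 when deg A is even and the leading coefficient is not a square,
    and when A is close to c^2 the three elements y, y - c and y + c vanish
    relative to c at three distinct places. If 3 deg A = 2 deg B and
    T^3 - a T + b has a root r, translating y by r x^k, which in
    characteristic 3 does not affect A, leads back to the previous case; two
    roots differ by a square root of a. If there is no root, the class of
    y / x^k generates a cubic extension of the residue field at any place
    above P. Finally, if 3 deg A < 2 deg B, then 3 v(y) = v(B) at any place, so
    3 divides the ramification index when it does not divide deg B. *)

(** * Calculus of valuations *)

Section Valuation.
Variable E : fieldType.
Implicit Types (Q : place E) (z w : E).

Lemma val0 Q : Q 0 = +oo%E.
Proof. by apply/eqP; rewrite val_of_eqy. Qed.

Lemma val1 Q : Q 1 = 0%E.
Proof.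
have [t t1] := val_of_normal Q.
have := val_ofM Q t 1; rewrite mulr1 t1.
by case: (Q 1) => [n||] //= [h]; congr (_%:E); lia.
Qed.

(** The integer underlying a valuation; only meaningful at nonzero elements,
    where it lets inequalities be settled by integer arithmetic. *)
Definition ord Q z : int := fine (Q z).

Lemma ordE Q z : z != 0 -> Q z = (ord Q z)%:E.
Proof.
move=> z0; have := val_ofM Q z z^-1; rewrite divff // val1 /ord.
by have := val_of_eqy Q z; rewrite (negPf z0); case: (Q z).
Qed.

Lemma ordM Q z w : z != 0 -> w != 0 -> ord Q (z * w) = ord Q z + ord Q w.
Proof.
by move=> z0 w0; rewrite {1}/ord val_ofM (ordE Q z0) (ordE Q w0).
Qed.

Lemma ord_one Q : ord Q 1 = 0.
Proof. by rewrite /ord val1. Qed.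

Lemma ordV Q z : z != 0 -> ord Q z^-1 = - ord Q z.
Proof.
move=> z0; have := ordM Q z0 (_ : z^-1 != 0).
by rewrite divff // ord_one invr_eq0 => /(_ z0); lia.
Qed.

Lemma ordX Q z n : z != 0 -> ord Q (z ^+ n) = n%:Z * ord Q z.
Proof.
move=> z0; elim: n => [|n IH]; first by rewrite expr0 ord_one mul0r.
by rewrite exprS ordM ?expf_neq0 // IH; lia.
Qed.

Lemma val_neq0 Q z (n : int) : Q z = n%:E -> z != 0.
Proof. by move=> zn; rewrite -(val_of_eqy Q) zn. Qed.

Lemma ord_val Q z (n : int) : Q z = n%:E -> ord Q z = n.
Proof. by rewrite /ord => ->. Qed.

Lemma valX Q z n : (0 < n)%N -> Q (z ^+ n) = (n%:Z%:E * Q z)%E.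
Proof.
move=> n0; have [->|z0] := eqVneq z 0.
  by rewrite expr0n eqn0Ngt n0 /= !val0 gt0_muley // lte_fin ltz_nat.
by rewrite !ordE ?expf_neq0 // ordX.
Qed.

Lemma valN1 Q : Q (-1) = 0%E.
Proof.
have n0 : (-1 : E) != 0 by rewrite oppr_eq0 oner_eq0.
have := ordM Q n0 n0; rewrite mulrNN mulr1 ord_one ordE // => h.
by congr (_%:E); lia.
Qed.

Lemma valN Q z : Q (- z) = Q z.
Proof. by rewrite -mulN1r val_ofM valN1 add0e. Qed.

Lemma val_add_ge Q z w (c : \bar int) :
  (c <= Q z)%E -> (c <= Q w)%E -> (c <= Q (z + w)%R)%E.
Proof.
by move=> cz cw; apply: le_trans (val_ofD Q z w); rewrite le_min cz.
Qed.

Lemma val_sub_ge Q z w (c : \bar int) :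
  (c <= Q z)%E -> (c <= Q w)%E -> (c <= Q (z - w)%R)%E.
Proof. by move=> cz cw; apply: val_add_ge; rewrite ?valN. Qed.

Lemma val_add_gt Q z w (c : \bar int) :
  (c < Q z)%E -> (c < Q w)%E -> (c < Q (z + w)%R)%E.
Proof.
by move=> cz cw; apply: lt_le_trans (val_ofD Q z w); rewrite lt_min cz.
Qed.

Lemma val_sub_gt Q z w (c : \bar int) :
  (c < Q z)%E -> (c < Q w)%E -> (c < Q (z - w)%R)%E.
Proof. by move=> cz cw; apply: val_add_gt; rewrite ?valN. Qed.

Lemma val_sum_ge Q (I : finType) (p : pred I) (f : I -> E) (c : \bar int) :
  (forall i, p i -> (c <= Q (f i))%E) -> (c <= Q (\sum_(i | p i) f i)%R)%E.
Proof.
move=> cf; elim/big_rec: _ => [|i z pi cz]; first by rewrite val0 leey.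
by apply: val_add_ge => //; apply: cf.
Qed.

Lemma val_add_lt Q z w : (Q z < Q w)%E -> Q (z + w) = Q z.
Proof.
move=> zw; apply/le_anti/andP; split; last by apply: val_add_ge => //; apply: ltW.
rewrite leNgt; apply/negP => h; suff : (Q z < Q z)%E by rewrite ltxx.
by rewrite -{2}(addrK w z); apply: val_sub_gt.
Qed.

Lemma val_eq0_sub Q z w : Q z = 0%E -> (0 < Q (w - z)%R)%E -> Q w = 0%E.
Proof.
by move=> z0 wz; rewrite -(subrK z w) addrC val_add_lt z0.
Qed.

Lemma val_mul_ge0 Q z w : (0 <= Q z)%E -> (0 <= Q w)%E -> (0 <= Q (z * w)%R)%E.
Proof. by rewrite val_ofM; apply: adde_ge0. Qed.

Lemma val_mul_gt0 Q z w : (0 < Q z)%E -> (0 <= Q w)%E -> (0 < Q (z * w)%R)%E.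
Proof.
by rewrite val_ofM; case: (Q z) (Q w) => [m||] [n||] //=;
  rewrite !(lte_fin, lee_fin); lia.
Qed.

Lemma valV Q z : z != 0 -> Q z^-1 = (- ord Q z)%:E.
Proof. by move=> z0; rewrite ordE ?invr_eq0 // ordV. Qed.

Lemma valXz Q z (n : int) : z != 0 -> Q (z ^ n) = (n * ord Q z)%:E.
Proof.
move=> z0; case: n => n; first by rewrite -exprnP ordE ?expf_neq0 // ordX.
by rewrite NegzE -exprnN valV ?expf_neq0 // ordX //; congr (_%:E); lia.
Qed.

Lemma val_div_gt0 Q z w : w != 0 -> (0 < Q (z / w)%R)%E = (Q w < Q z)%E.
Proof.
move=> w0; have [->|z0] := eqVneq z 0.
  by rewrite mul0r val0 ltry ordE // ltry.
rewrite val_ofM valV // !ordE // !lte_fin; apply/idP/idP; lia.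
Qed.

Lemma val_div_ge0 Q z w : w != 0 -> (0 <= Q (z / w)%R)%E = (Q w <= Q z)%E.
Proof.
move=> w0; have [->|z0] := eqVneq z 0; first by rewrite mul0r val0 !leey.
rewrite val_ofM valV // !ordE // !lee_fin; apply/idP/idP; lia.
Qed.

(** Rank one: a place whose valuation ring contains that of another one has
    the same units, hence also the same normalized valuation. *)
Lemma place_eq_of_le Q Q' :
  (forall z, (0 <= Q z)%E -> (0 <= Q' z)%E) -> Q =1 Q'.
Proof.
move=> sub.
have unit z : z != 0 -> ord Q z = 0 -> ord Q' z = 0.
  move=> z0 Qz.
  have := sub z; have := sub z^-1; rewrite !valV // !(ordE _ z0) !lee_fin Qz.
  by move=> /(_ isT) h1 /(_ isT) h2; lia.
have [t t1] := val_of_normal Q; have t0 := val_neq0 t1.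
have [s s1] := val_of_normal Q'; have s0 := val_neq0 s1.
have key z : z != 0 -> ord Q' z = ord Q z * ord Q' t.
  move=> z0; set n := ord Q z.
  have tn0 : t ^ n != 0 by rewrite expfz_neq0.
  have ordtn R : ord R (t ^ n) = n * ord R t by rewrite (ord_val (valXz _ _ t0)).
  have := unit (z / t ^ n); rewrite !ordM ?invr_eq0 // !ordV // !ordtn.
  by rewrite (ord_val t1) mulf_neq0 ?invr_eq0 // => /(_ isT) h; lia.
have d1 : ord Q' t = 1.
  have := key s s0; rewrite (ord_val s1).
  have := sub t; rewrite t1 => /(_ isT); rewrite (ordE _ t0) lee_fin.
  case: (ord Q' t) => // d _; have [->|dn1] := eqVneq d 1%N; first by [].
  move=> h; have : (d %| 1)%N.
    by have := congr1 absz h; rewrite abszM /= => ->; apply: dvdn_mull.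
  by rewrite dvdn1 (negPf dn1).
move=> z; have [->|z0] := eqVneq z 0; first by rewrite !val0.
by rewrite !ordE // key // d1 mulr1.
Qed.

End Valuation.

(** * Weak approximation *)

Section Approximation.
Variable E : fieldType.

(** Neither of two distinct valuation rings contains the other; the quotient of
    two witnesses has a pole at one place and a zero at the other. *)
Lemma place_separation (Q Q' : place E) :
  ~ Q =1 Q' -> exists z, (Q z < 0)%E /\ (0 < Q' z)%E.
Proof.
move=> QQ'.
have split (R R' : place E) : ~ R =1 R' -> exists u, (0 <= R u)%E /\ (R' u < 0)%E.
  move=> RR'; apply: boolp.contrapT => nu; apply: RR'; apply: place_eq_of_le.
  move=> z Rz; rewrite leNgt; apply/negP => R'z; apply: nu.
  by exists z.
have [u [Qu Q'u]] := split _ _ QQ'.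
have [v [Q'v Qv]] := split _ _ (fun h => QQ' (fsym h)).
have u0 : u != 0 by apply: contraTneq Q'u => ->; rewrite val0.
have v0 : v != 0 by apply: contraTneq Qv => ->; rewrite val0.
exists (v / u); move: Qu Q'u Q'v Qv.
rewrite !val_ofM !valV // !(ordE _ u0) !(ordE _ v0) -!EFinD !lee_fin !lte_fin.
by lia.
Qed.

(** Starting from separating elements, the powers of z are used to make all
    the valuations of a product follow those of z wherever these are nonzero;
    where z has a pole at the new place, z^r / (1 + z^r) is a unit there. *)
Lemma place_separation_seq (I : eqType) (Q : I -> place E) (Q0 : place E)
    (s : seq I) :
  (forall i, i \in s -> ~ Q0 =1 Q i) ->
  exists z, (Q0 z < 0)%E /\ forall i, i \in s -> (0 < Q i z)%E.
Proof.
elim: s => [|j s IH] dist.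
  have [t t1] := val_of_normal Q0; have t0 := val_neq0 t1.
  by exists t^-1; split=> //; rewrite valV // (ord_val t1).
have [i si|z [z0 zs]] := IH; first by apply: dist; rewrite inE si orbT.
have [w [w0 wj]] := place_separation (dist j (mem_head _ _)).
have zn0 : z != 0 by apply: contraTneq z0 => ->; rewrite val0.
have wn0 : w != 0 by apply: contraTneq w0 => ->; rewrite val0.
(* r exceeds all possible pole orders of w at the places treated so far *)
have [r [r0 rs]] : exists r, (0 < r)%N /\
    forall i, i \in s -> (0 < Q i (z ^+ r * w)%R)%E.
  exists (\sum_(i <- s) absz (ord (Q i) w)).+1; split=> // i si.
  rewrite ordE ?mulf_neq0 ?expf_neq0 // lte_fin ordM ?expf_neq0 // ordX //.
  have := zs _ si; rewrite ordE // lte_fin => zi.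
  have : (absz (ord (Q i) w) <= \sum_(k <- s) absz (ord (Q k) w))%N.
    by rewrite (big_rem i si) leq_addr.
  by move: (\sum_(k <- s) _)%N => N h; nia.
have zr0 : z ^+ r != 0 by rewrite expf_neq0.
have ordzr R : ord R (z ^+ r) = r%:Z * ord R z by rewrite ordX.
have [zj|zj] := leP 0%E (Q j z).
  exists (z ^+ r * w); split.
    move: z0 w0; rewrite val_ofM valX // (ordE _ zn0) (ordE _ wn0) -EFinM.
    by rewrite -EFinD !lte_fin; nia.
  move=> i; rewrite inE => /orP[/eqP->|/rs//].
  move: wj zj; rewrite val_ofM valX // (ordE _ zn0) (ordE _ wn0) -EFinM.
  by rewrite -EFinD !lte_fin lee_fin; nia.
have pole (R : place E) : (R z < 0)%E -> R (1 + z ^+ r) = R (z ^+ r).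
  move=> Rz; rewrite addrC val_add_lt // val1 valX // (ordE _ zn0) -EFinM.
  by move: Rz; rewrite ordE // !lte_fin; nia.
have d0 : 1 + z ^+ r != 0.
  by rewrite -(val_of_eqy Q0) pole // ordE.
exists (z ^+ r * w / (1 + z ^+ r)); split.
  rewrite val_ofM valV // (ord_val (_ : _ = (ord Q0 (z ^+ r))%:E)).
    by move: w0; rewrite val_ofM !ordE // -!EFinD !lte_fin; lia.
  by rewrite pole // ordE.
move=> i; rewrite inE => /orP[/eqP->|si].
  rewrite val_ofM valV // (ord_val (_ : _ = (ord (Q j) (z ^+ r))%:E)).
    by move: wj; rewrite val_ofM !ordE // -!EFinD !lte_fin; lia.
  by rewrite pole // ordE.
rewrite val_ofM valV // (ord_val (_ : _ = 0%E)) ?oppr0 ?adde0; first exact: rs.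
rewrite val_add_lt ?val1 // valX // (ordE _ zn0) -EFinM.
by have := zs _ si; rewrite ordE // !lte_fin; nia.
Qed.

(** If z has a pole at one place and zeros at the others, then z / (1 + z) is a
    unit at the first place and still has zeros at the others. *)
Lemma place_unit_approximation (I : finType) (Q : I -> place E) (i : I) :
  (forall j, j != i -> ~ Q i =1 Q j) ->
  exists z, Q i z = 0%E /\ forall j, j != i -> (0 < Q j z)%E.
Proof.
move=> dist; have [j|z [zi zs]] :=
  @place_separation_seq I Q (Q i) [seq j <- enum I | j != i].
  by rewrite mem_filter => /andP[/dist].
have zn0 : z != 0 by apply: contraTneq zi => ->; rewrite val0.
have pole : Q i (1 + z) = Q i z by rewrite addrC val_add_lt // val1.
have d0 : 1 + z != 0 by rewrite -(val_of_eqy (Q i)) pole ordE.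
exists (z / (1 + z)); split.
  rewrite val_ofM valV // (ord_val (_ : _ = (ord (Q i) z)%:E)) ?pole ?ordE //.
  by rewrite -EFinD; congr (_%:E); lia.
move=> j ji; have zj : (0 < Q j z)%E by apply: zs; rewrite mem_filter ji mem_enum.
by rewrite val_ofM valV // (ord_val (_ : _ = 0%E)) ?oppr0 ?adde0 // val_add_lt val1.
Qed.

End Approximation.

(** * Places of a finite extension *)

Section ScalarEmbedding.
Variables (K : fieldType) (L : fieldExtType K).

Lemma scale_neq0 (z : K) : z != 0 -> z%:A != 0 :> L.
Proof. by move=> z0; rewrite scaler_eq0 negb_or z0 oner_neq0. Qed.

Lemma algM (z w : K) : (z * w)%:A = z%:A * w%:A :> L.
Proof. by rewrite -[LHS]/(in_alg L (z * w)) rmorphM. Qed.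

Lemma algD (z w : K) : (z + w)%:A = z%:A + w%:A :> L.
Proof. exact: scalerDl. Qed.

Lemma algN (z : K) : (- z)%:A = - z%:A :> L.
Proof. exact: scaleNr. Qed.

Lemma algV (z : K) : (z^-1)%:A = (z%:A)^-1 :> L.
Proof. by rewrite -[LHS]/(in_alg L _) fmorphV. Qed.

Lemma algX (z : K) n : (z ^+ n)%:A = (z%:A) ^+ n :> L.
Proof. by rewrite -[LHS]/(in_alg L _) rmorphXn. Qed.

Lemma alg1 : 1%:A = 1 :> L.
Proof. exact: scale1r. Qed.

Lemma alg0 : 0%:A = 0 :> L.
Proof. exact: scale0r. Qed.

Lemma alg_inj (z w : K) : z%:A = w%:A :> L -> z = w.
Proof. exact: (fmorph_inj (in_alg L)). Qed.

Definition algE := (algD, algN, algM, algV, algX, alg1, alg0).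

End ScalarEmbedding.

Arguments scale_neq0 {K L z}.

Section Above.
Variables (K : fieldType) (L : fieldExtType K) (P : place K).
Implicit Types (Q : place L).

Lemma val_ramified Q e (z : K) : ramification_index Q P e -> z != 0 ->
  ord Q z%:A = e%:Z * ord P z.
Proof. by move=> Qe z0; rewrite /ord Qe ordE. Qed.

Lemma ramification_ge0 Q e (z : K) : ramification_index Q P e -> (0 < e)%N ->
  (0 <= Q z%:A)%E = (0 <= P z)%E.
Proof.
move=> Qe e0; rewrite Qe; have [->|z0] := eqVneq z 0.
  by rewrite val0 gt0_muley // lte_fin ltz_nat.
by rewrite ordE // -EFinM !lee_fin; apply/idP/idP; nia.
Qed.

Lemma ramification_gt0 Q e (z : K) : ramification_index Q P e -> (0 < e)%N ->
  (0 < Q z%:A)%E = (0 < P z)%E.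
Proof.
move=> Qe e0; rewrite Qe; have [->|z0] := eqVneq z 0.
  by rewrite val0 gt0_muley // lte_fin ltz_nat.
by rewrite ordE // -EFinM !lte_fin; apply/idP/idP; nia.
Qed.

(** A unit u of the smaller place remains one: for a uniformizer t, all the
    u^n t with n an integer have positive valuation. *)
Lemma lies_above_ramified Q : lies_above Q P ->
  exists e, (0 < e)%N /\ ramification_index Q P e.
Proof.
move=> QP; have [t t1] := val_of_normal P; have t0 := val_neq0 t1.
have := QP t; rewrite t1 => /(_ isT).
rewrite (ordE _ (scale_neq0 t0)) lte_fin => et.
set e := ord Q t%:A in et.
have unit_ge (u : K) : u != 0 -> ord P u = 0 -> 0 <= ord Q u%:A.
  move=> u0 Pu; have ua := scale_neq0 u0.
  have un0 : u ^+ (absz e) != 0 by rewrite expf_neq0.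
  have := QP (u ^+ (absz e) * t); rewrite !ordE ?scale_neq0 ?mulf_neq0 // !lte_fin.
  rewrite ordM // ordX // Pu (ord_val t1) mulr0 => /(_ isT).
  rewrite algM ordM ?scale_neq0 //.
  have -> : (u ^+ absz e)%:A = (u%:A) ^+ absz e :> L.
    by rewrite -[LHS]/(in_alg L _) rmorphXn.
  rewrite ordX ?scale_neq0 // -/e gez0_abs; last by lia.
  by move: et (ord Q u%:A); clear; nia.
have unit (u : K) : u != 0 -> ord P u = 0 -> ord Q u%:A = 0.
  move=> u0 Pu; have uv0 : u^-1 != 0 by rewrite invr_eq0.
  have := unit_ge u u0 Pu; have := unit_ge u^-1 uv0; rewrite ordV // Pu.
  move=> /(_ (oppr0 _)).
  have -> : (u^-1)%:A = (u%:A)^-1 :> L.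
    by rewrite -[LHS]/(in_alg L _) fmorphV.
  rewrite ordV ?scale_neq0 //; move: (ord Q u%:A); clear; lia.
exists (absz e); split; first by lia.
move=> z; have [->|z0] := eqVneq z 0.
  by rewrite scale0r !val0 gt0_muley // lte_fin; lia.
have tz0 : t ^ ord P z != 0 by rewrite expfz_neq0.
have := unit (z / t ^ ord P z); rewrite mulf_neq0 ?invr_eq0 // => /(_ isT).
rewrite ordM ?invr_eq0 // ordV // (ord_val (valXz _ _ t0)) (ord_val t1).
move=> h; have {h} : ord Q (z / t ^ ord P z)%:A = 0 by apply: h; lia.
have -> : (z / t ^ ord P z)%:A = z%:A / (t%:A) ^ ord P z :> L.
  by rewrite -[LHS]/(in_alg L _) rmorphM fmorphV fmorphXz.
rewrite ordM ?invr_eq0 ?expfz_neq0 ?scale_neq0 // ordV ?expfz_neq0 ?scale_neq0 //.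
rewrite (ord_val (valXz _ _ (scale_neq0 t0))) -/e !ordE ?scale_neq0 // -EFinM.
rewrite gez0_abs; last exact: ltW.
by move: (ord Q z%:A) (ord P z) => n m; clear; move=> h; congr (_%:E); lia.
Qed.

Definition residue_free Q (T : finType) (b : T -> L) : Prop :=
  (forall k, (0 <= Q (b k))%E) /\
  forall c : T -> K, (forall k, (0 <= P (c k))%E) ->
    (0 < Q (\sum_k c k *: b k)%R)%E -> forall k, (0 < P (c k))%E.

(** Linear independence in the quotient of the valuation ring of Q by the
    ideal generated by a uniformizer of P, an ideal that consists of the
    elements of valuation at least e when e is the ramification index. *)
Definition free_mod Q (e : nat) (T : finType) (w : T -> L) : Prop :=
  (forall k, (0 <= Q (w k))%E) /\
  forall c : T -> K, (forall k, (0 <= P (c k))%E) ->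
    (e%:Z%:E <= Q (\sum_k c k *: w k)%R)%E -> forall k, (0 < P (c k))%E.

(** The filtration of the quotient by the powers of a uniformizer t of Q has
    e steps, each a copy of the residue field; coefficients are shown to
    vanish modulo P one step after the other. *)
Lemma residue_free_mod Q e (T : finType) (b : T -> L) (t : L) :
  ramification_index Q P e -> (0 < e)%N -> Q t = 1%E -> residue_free Q b ->
  free_mod Q e (fun jk : 'I_e * T => t ^+ jk.1 * b jk.2).
Proof.
move=> Qe e0 t1 [b0 bfree]; have t0 := val_neq0 t1.
have Qt j : Q (t ^+ j) = j%:Z%:E.
  by rewrite ordE ?expf_neq0 // ordX // (ord_val t1) mulr1.
have Qt0 j : (0 <= Q (t ^+ j)%R)%E by rewrite Qt lee_fin.
split=> [jk|c c0 Qc]; first by apply: val_mul_ge0.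
suff cl (j : nat) (ltj : (j < e)%N) : forall k, (0 < P (c (Ordinal ltj, k)))%E.
  by move=> [[j ltj] k]; apply: cl.
elim/ltn_ind: j ltj => j IH ltj; pose oj := Ordinal ltj.
pose S i := \sum_k c (i, k) *: b k.
have sumE : \sum_jk c jk *: (t ^+ jk.1 * b jk.2) = \sum_(i < e) t ^+ i * S i.
  rewrite (reindex (fun p : 'I_e * T => (p.1, p.2))) /=; last first.
    by exists id => -[].
  rewrite -(pair_bigA _ (fun i k => c (i, k) *: (t ^+ i * b k))) /=.
  apply: eq_bigr => i _; rewrite mulr_sumr.
  by apply: eq_bigr => k _; rewrite scalerAr.
have Sge (i : 'I_e) (n : int) : (forall k, (n%:E <= Q (c (i, k))%:A)%E) ->
    (n%:E <= Q (S i))%E.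
  move=> h; apply: val_sum_ge => k _; rewrite -mulr_algl val_ofM.
  by rewrite -[n%:E]adde0; apply: leeD.
have cA i k : (0 <= Q (c (i, k))%:A)%E by rewrite (ramification_ge0 _ Qe).
move=> k0; apply: (bfree (fun k => c (oj, k))) => //; rewrite -/(S oj).
suff : ((j.+1)%:Z%:E <= Q (t ^+ j * S oj)%R)%E.
  rewrite val_ofM Qt; case: (Q (S oj)) => [n||] //=.
  by rewrite -EFinD !(lee_fin, lte_fin); lia.
have -> : t ^+ j * S oj =
    \sum_(i < e) t ^+ i * S i - \sum_(i < e | i != oj) t ^+ i * S i.
  by rewrite (bigD1 oj) //= addrK.
apply: val_sub_ge.
  by rewrite -sumE; apply: le_trans Qc; rewrite lee_fin lez_nat.
apply: val_sum_ge => i ij; have [lij|] := ltnP i j.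
  rewrite -[_%:E]add0e val_ofM; apply: leeD => //.
  apply: Sge => k; have := IH i lij (ltn_ord i) k.
  rewrite (_ : Ordinal _ = i) ?Qe; last exact: val_inj.
  case: (P _) => [n||] //=; last by rewrite gt0_muley ?leey // lte_fin ltz_nat.
  by rewrite -EFinM lee_fin lte_fin; nia.
rewrite leq_eqVlt => /orP[/eqP ji|ji].
  by move: ij; rewrite -val_eqE /= ji eqxx.
rewrite -[_%:E]adde0 val_ofM Qt; apply: leeD; last exact: (Sge i 0).
by rewrite lee_fin lez_nat.
Qed.

Lemma dim_lower_bound (T : finType) (w : T -> L) :
  (forall c : T -> K, \sum_t c t *: w t = 0 -> forall t, c t = 0) ->
  (#|T| <= \dim {:L})%N.
Proof.
move=> wfree; pose X := [tuple w (enum_val i) | i < #|T|].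
have : free X.
  apply/freeP => k; under eq_bigr => i _ do rewrite -tnth_nth tnth_mktuple.
  move=> k0 i; rewrite -[i](enum_valK); apply: (wfree (fun t => k (enum_rank t))).
  rewrite -[RHS]k0 (reindex enum_rank) /=; last exact/onW_bij/enum_rank_bij.
  by apply: eq_bigr => t _; rewrite enum_rankK.
move=> /eqP; rewrite size_tuple => <-; exact: dimvS (subvf _).
Qed.

(** Families independent modulo P at distinct places are made almost zero at
    all other places by multiplying them with high powers of local units;
    a linear relation over K, scaled so that its coefficients are integral but
    not all divisible by P, would then contradict independence at the place
    of a unit coefficient. *)
Theorem free_mod_card (I : finType) (Q : I -> place L) (e : I -> nat)
    (T : I -> finType) (w : forall i, T i -> L) :
  (forall i j, Q i =1 Q j -> i = j) ->
  (forall i, (0 < e i)%N) -> (forall i, ramification_index (Q i) P (e i)) ->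
  (forall i, free_mod (Q i) (e i) (w i)) ->
  (\sum_i #|T i| <= \dim {:L})%N.
Proof.
move=> Qinj e0 Qe wfree.
have /boolp.choice[z zP] (i : I) : exists z, Q i z = 0%E /\
    forall j, j != i -> (0 < Q j z)%E.
  apply: place_unit_approximation => j ji Qij.
  by move: ji; rewrite (Qinj _ _ Qij) eqxx.
(* large enough for the zeros of the z i to absorb the poles of the w i k and
   to reach the valuation e j *)
pose M := (\sum_i e i + \sum_j \sum_i \sum_(k : T i) absz (ord (Q j) (w i k)))%N.
have zn0 i : z i != 0 by apply: (@val_neq0 _ (Q i) _ 0); case: (zP i).
have zM i j (k : T i) : j != i -> ((e j)%:Z%:E <= Q j (z i ^+ M * w i k)%R)%E.
  move=> ji; have [->|w0] := eqVneq (w i k) 0; first by rewrite mulr0 val0 leey.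
  rewrite ordE ?mulf_neq0 ?expf_neq0 // ordM ?expf_neq0 // ordX // lee_fin.
  have := (zP i).2 j ji; rewrite ordE // lte_fin.
  have : (e j + absz (ord (Q j) (w i k)) <= M)%N.
    apply: leq_add; first by rewrite (bigD1 j) //= leq_addr.
    rewrite (bigD1 j) //= (bigD1 i) //= (bigD1 k) //=.
    by rewrite -!addnA leq_addr.
  by move: (ord _ (z i)) (ord _ _) (M) (e j) => m n N f; clear; nia.
have zM0 i : Q i (z i ^+ M) = 0%E.
  by rewrite ordE ?expf_neq0 // ordX // (ord_val (zP i).1) mulr0.
suff h : (#|{: {i : I & T i}}| <= \dim {:L})%N by rewrite card_tagged sumnE big_map big_enum in h.
pose W (p : {i : I & T i}) := z (tag p) ^+ M * w (tag p) (tagged p).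
apply: (@dim_lower_bound _ W) => c cW0 p0; apply: boolp.contrapT => /eqP cp0.
have [p cp pmin] := @arg_minP _ _ _ p0 (fun p => c p != 0) (fun p => ord P (c p)) cp0.
pose c' q := c q / c p.
have c'0 q : (0 <= P (c' q))%E.
  have [cq|cq] := eqVneq (c q) 0; first by rewrite /c' cq mul0r val0 leey.
  rewrite /c' ordE ?mulf_neq0 ?invr_eq0 // ordM ?invr_eq0 // ordV // lee_fin.
  by have := pmin q cq; lia.
pose i := tag p; have [w0 wi] := wfree i.
pose tg j (k : T j) : {i : I & T i} := Tagged T k.
have tgp : tg i (tagged p) = p by rewrite /i; case: (p).
suff : (0 < P (c' (tg i (tagged p))))%E by rewrite tgp /c' divff // val1 ltxx.
apply: (wi (fun k => c' (tg i k))) => //.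
pose S := \sum_k c' (tg i k) *: w i k; rewrite -/S.
pose V j := \sum_k c' (tg j k) *: W (tg j k).
have sum0 : \sum_j V j = 0.
  rewrite /V (sig_big_dep _ (fun _ => xpredT) (fun j k => c' (tg j k) *: W (tg j k))).
  transitivity ((c p)^-1 *: \sum_q c q *: W q); last by rewrite cW0 scaler0.
  rewrite scaler_sumr.
  by apply: eq_bigr => -[j k] _; rewrite scalerA mulrC.
have -> : Q i S = Q i (z i ^+ M * S)%R by rewrite val_ofM zM0 add0e.
have -> : z i ^+ M * S = - \sum_(j | j != i) V j.
  apply/eqP; rewrite -addr_eq0 -[X in _ == X]sum0 [X in _ == X](bigD1 i) //=.
  apply/eqP; congr (_ + _); rewrite mulr_sumr.
  by apply: eq_bigr => k _; rewrite scalerAr.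
rewrite valN; apply: val_sum_ge => j ji; apply: val_sum_ge => k _.
rewrite -mulr_algl val_ofM -[X in (X <= _)%E]add0e; apply: leeD.
  by rewrite (ramification_ge0 _ (Qe i)).
by apply: zM; rewrite eq_sym.
Qed.

(** The e_i f_i products of powers of a uniformizer with lifts of independent
    residue classes form the families to which the previous bound applies. *)
Theorem fundamental_inequality (I : finType) (Q : I -> place L) (e f : I -> nat) :
  (forall i j, Q i =1 Q j -> i = j) ->
  (forall i, (0 < e i)%N) -> (forall i, ramification_index (Q i) P (e i)) ->
  (forall i, exists b : 'I_(f i) -> L, residue_free (Q i) b) ->
  (\sum_i e i * f i <= \dim {:L})%N.
Proof.
move=> Qinj e0 Qe bfree.
have unif i : exists t, Q i t = 1%E by apply: val_of_normal.
have [t t1] := boolp.choice unif.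
have bP i := boolp.cid (bfree i).
have -> : (\sum_i e i * f i = \sum_i #|{: 'I_(e i) * 'I_(f i)}|)%N.
  by apply: eq_bigr => i _; rewrite card_prod !card_ord.
apply: (free_mod_card Qinj e0 Qe) => i.
exact: residue_free_mod (Qe i) (e0 i) (t1 i) (svalP (bP i)).
Qed.

Lemma residue_free1 Q : lies_above Q P -> exists b : 'I_1 -> L, residue_free Q b.
Proof.
move=> /lies_above_ramified[e [e0 Qe]]; exists (fun=> 1); split=> [k|c _].
  by rewrite val1.
by rewrite big_ord1 (ramification_gt0 _ Qe e0) => c0 k; rewrite (ord1 k).
Qed.

(** In a relation modulo Q the coefficient of z cannot be a unit, for z would
    then be congruent to a combination of the b_i. *)
Lemma residue_free_rcons Q f (b : 'I_f -> L) z :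
  lies_above Q P -> residue_free Q b -> (0 <= Q z)%E ->
  ~ (exists2 c : 'I_f -> K, (forall i, (0 <= P (c i))%E)
       & (0 < Q (z - \sum_i c i *: b i)%R)%E) ->
  exists b' : 'I_f.+1 -> L, residue_free Q b'.
Proof.
move=> /lies_above_ramified[e [e0 Qe]] [b0 bfree] z0 nz.
pose b' k := if unlift ord0 k is Some j then b j else z.
exists b'; split=> [k|c c0]; first by rewrite /b'; case: unliftP => [j _|_].
rewrite big_ord_recl /b' unlift_none.
under eq_bigr => i _ do rewrite liftK.
move=> Qc; have Pc : (0 < P (c ord0))%E.
  rewrite lt_def c0 andbT; apply/eqP => Pc0; apply: nz.
  have cn0 := val_neq0 Pc0.
  have cV : P (c ord0)^-1 = 0%E by rewrite valV // (ord_val Pc0) oppr0.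
  exists (fun i => - ((c ord0)^-1 * c (lift ord0 i))) => [i|].
    by rewrite valN val_mul_ge0 ?cV.
  under eq_bigr => i _ do rewrite scaleNr -scalerA.
  rewrite sumrN opprK -scaler_sumr -[X in X + _]scale1r -(mulVf cn0) -scalerA.
  by rewrite -scalerDr -mulr_algl val_ofM Qe cV mule0 add0e.
move=> k; case: (unliftP ord0 k) => [j ->|-> //].
apply: (bfree (fun i => c (lift ord0 i))) => //.
rewrite -[X in Q X](addKr (c ord0 *: z)) addrC.
apply: val_sub_gt => //; rewrite -mulr_algl; apply: val_mul_gt0 => //.
by rewrite (ramification_gt0 _ Qe).
Qed.

(** Lower bounds for the ramification indices and for the residue degrees of
    some places determine everything once they add up to the degree: by the
    fundamental inequality there is no room for a further place, for a larger
    ramification index or for a residue class outside the span. *)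
Theorem signature_of_lower_bounds m (Q : 'I_m -> place L) (e f : 'I_m -> nat) :
  (forall i j, Q i =1 Q j -> i = j) ->
  (forall i, lies_above (Q i) P) ->
  (forall i E, (0 < E)%N -> ramification_index (Q i) P E -> (e i <= E)%N) ->
  (forall i, (0 < e i)%N /\ (0 < f i)%N) ->
  (forall i, exists b : 'I_(f i) -> L, residue_free (Q i) b) ->
  (\sum_i e i * f i = \dim {:L})%N ->
  let ef := [seq (e i, f i) : nat *l nat | i <- enum 'I_m] in
  sorted <=%O ef ->
  signature L P (flatten [seq [:: p.1; p.2] | p <- ef]).
Proof.
move=> Qinj QP Qe ef0 Qf dimE ef efsort.
have [E EP] := boolp.choice (fun i => lies_above_ramified (QP i)).
have E0 i := (EP i).1; have QE i := (EP i).2.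
have eE i : E i = e i.
  apply/eqP; rewrite eqn_leq Qe // andbT.
  have := fundamental_inequality Qinj E0 QE Qf; rewrite -dimE.
  rewrite (bigD1 i) //= [X in (_ <= X)%N](bigD1 i) //= leqNgt => h.
  rewrite leqNgt; apply: contra h => h.
  rewrite -addSn leq_add //; first by have [_ fi] := ef0 i; rewrite ltn_pmul2r.
  by apply: leq_sum => j _; rewrite leq_mul2r Qe ?orbT.
have {eE E0 QE EP} QE i : ramification_index (Q i) P (e i) by rewrite -eE.
exists m, Q, e, f; split=> //.
- split=> // Q'; split=> [Q'P|[i Q'i]]; last first.
    by move=> z /(QP i); rewrite Q'i.
  apply: boolp.contrapT => nQ'.
  (* the new place is put at index 0, with residue degree at least 1 *)
  have [e' [e'0 Q'e]] := lies_above_ramified Q'P.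
  suff : (\sum_(k < m.+1) oapp e e' (unlift ord0 k) * oapp f 1 (unlift ord0 k)
      <= \dim {:L})%N.
    rewrite -dimE big_ord_recl unlift_none /= muln1.
    by under eq_bigr => i _ do rewrite liftK /=; rewrite -[X in (_ <= X)%N]add0n leq_add2r leqNgt e'0.
  apply: (@fundamental_inequality _ (fun k => oapp Q Q' (unlift ord0 k)))
    => [k l|k|k|k].
  - case: (unliftP ord0 k) (unliftP ord0 l) => [i ->|->] [j ->|->] //=.
    + by move=> /Qinj->.
    + by move=> h; case: nQ'; exists i => z; rewrite h.
    + by move=> h; case: nQ'; exists j => z; rewrite h.
  - by case: unliftP => [i _|_] //=; case: (ef0 i).
  - by case: unliftP => [i _|_] /=.
  - by case: unliftP => [i _|_] //=; apply: residue_free1.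
- move=> i; have [b bfree] := Qf i.
  exists b; split; [exact: bfree.1| |exact: bfree.2].
  move=> z z0; apply: boolp.contrapT => nz.
  (* z would raise the bound on the residue degree of Q i by 1 *)
  have := @fundamental_inequality _ Q e (fun j => f j + (j == i))%N Qinj
    (fun j => (ef0 j).1) QE.
  have Qf' j : exists b : 'I_(f j + (j == i)) -> L, residue_free (Q j) b.
    case: eqP => [->|_]; last by rewrite addn0.
    by rewrite addn1; apply: (residue_free_rcons (QP i) bfree z0).
  move=> /(_ Qf'); under eq_bigr => j _ do rewrite mulnDr.
  rewrite big_split /= dimE (bigD1 i) //= eqxx muln1.
  by rewrite -[X in (_ <= X)%N]addn0 leq_add2l leqn0 addn_eq0 eqn0Ngt (ef0 i).1.
Qed.

End Above.

(** * Chevalley's extension theorem *)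

Section ValuationRings.
Variable E : fieldType.
Implicit Types (R V : E -> Prop) (x : E).

Definition is_subring R : Prop :=
  [/\ R 1, forall a b, R a -> R b -> R (a - b) & forall a b, R a -> R b -> R (a * b)].

Definition ideal2 R (p s a : E) : Prop :=
  exists u v, [/\ R u, R v & a = p * u + s * v].

Lemma subring0 R : is_subring R -> R 0.
Proof. by case=> R1 RB _; rewrite -(subrr 1); apply: RB. Qed.

Lemma subringD R a b : is_subring R -> R a -> R b -> R (a + b).
Proof.
move=> Rr Ra Rb; have [_ RB _] := Rr; rewrite -[b]opprK; apply: (RB) => //.
by rewrite -sub0r; apply: RB => //; apply: subring0.
Qed.

Lemma subring_sum R (I : Type) (r : seq I) (pr : pred I) (f : I -> E) :
  is_subring R -> (forall i, pr i -> R (f i)) -> R (\sum_(i <- r | pr i) f i).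
Proof.
move=> Rr Rf; apply: (big_ind R) => //; first exact: subring0.
by move=> a b; apply: subringD.
Qed.

Lemma subringX R x n : is_subring R -> R x -> R (x ^+ n).
Proof.
move=> [R1 _ RM] Rx; elim: n => [|n IH]; first by rewrite expr0.
by rewrite exprS; apply: RM.
Qed.

Section Ideal.
Variables (R : E -> Prop) (p s : E).
Hypotheses (Rr : is_subring R) (Rp : R p) (Rs : R s).
Let J := ideal2 R p s.

Lemma ideal2_sub a : J a -> R a.
Proof.
by case: Rr => _ _ RM [u [v [Ru Rv ->]]]; apply: subringD => //; apply: RM.
Qed.

Lemma ideal2D a b : J a -> J b -> J (a + b).
Proof.
move=> [u [v [Ru Rv ->]]] [u' [v' [Ru' Rv' ->]]].
exists (u + u'), (v + v'); split; try exact: subringD.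
by ring.
Qed.

Lemma ideal2M a b : R a -> J b -> J (a * b).
Proof.
case: Rr => _ _ RM Ra [u [v [Ru Rv ->]]].
by exists (a * u), (a * v); split; [exact: RM|exact: RM|ring].
Qed.

Lemma ideal2_0 : J 0.
Proof. by exists 0, 0; split; [exact: subring0|exact: subring0|ring]. Qed.

(** Of two relations placing 1 in the extensions of J to R[x] and R[1/x], the
    one of larger degree n has its leading term u x^n rewritten by means of
    the other one, q(1/x) = 1: multiplying by 1 - q(0) turns
    x^n (1 - q(0)) into a polynomial of degree less than n. *)
Lemma ideal2_inverse_relations x (a b : {poly E}) : x != 0 -> ~ J 1 ->
  (forall i, J a`_i) -> (forall i, J b`_i) -> a.[x] = 1 -> b.[x^-1] = 1 -> False.
Proof.
move=> x0 J1; have [k] := ubnP (size a + size b).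
elim: k x x0 a b => // k IH x x0 a b sab Ja Jb ax bx.
wlog ba : x x0 a b Ja Jb ax bx sab / (size b <= size a)%N.
  move=> W; have [|/ltnW] := leqP (size b) (size a); first exact: (W x).
  by apply: (W x^-1); rewrite ?invr_eq0 ?invrK // addnC.
have a2 : (1 < size a)%N.
  rewrite ltnNge; apply/negP => /size1_polyC aE; apply: J1.
  by move: ax; rewrite aE hornerC => <-.
pose n := (size a).-1; have sa : size a = n.+1 by rewrite /n prednK // ltnW.
have n0 : (0 < n)%N by rewrite -ltnS -sa.
pose c i := (1 - b`_0) * a`_i + (b`_0 *+ (i == 0%N)) + a`_n * b`_(n - i).
have [R1 RB RM] := Rr.
have Jc i : J (c i).
  apply: ideal2D; last by apply: ideal2M => //; apply: ideal2_sub.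
  apply: ideal2D.
    by apply: ideal2M => //; apply: RB => //; apply: ideal2_sub.
  by rewrite mulrb; case: ifP => _ //; apply: ideal2_0.
apply: (IH x x0 (\poly_(i < n) c i) b) => //.
- apply: leq_ltn_trans (leq_add (size_poly _ _) (leqnn _)) _.
  by move: sab; rewrite sa addSn ltnS.
- by move=> i; rewrite coef_poly; case: ifP => // _; apply: ideal2_0.
have axE : \sum_(i < n) a`_i * x ^+ i = 1 - a`_n * x ^+ n.
  by rewrite -ax horner_coef sa big_ord_recr /= addrK.
have bxE : \sum_(i < n) b`_(n - i) * x ^+ i = x ^+ n * (1 - b`_0).
  have -> : 1 - b`_0 = \sum_(i < n) b`_i.+1 * x^-1 ^+ i.+1.
    rewrite -[X in X - _]bx (@horner_coef_wide _ n.+1) ?(leq_trans ba) ?sa //.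
    by rewrite big_ord_recl expr0 mulr1 addrC addKr.
  rewrite mulr_sumr (reindex_inj rev_ord_inj) /=; apply: eq_bigr => i _.
  rewrite subKn // mulrCA exprVn; congr (_ * _).
  by apply: (mulIf (expf_neq0 i.+1 x0)); rewrite divfK ?expf_neq0 // -exprD subnK.
rewrite horner_poly /c.
under eq_bigr => i _ do rewrite !mulrDl -!mulrA.
rewrite !big_split /= -!mulr_sumr axE bxE.
rewrite (bigD1 (Ordinal n0)) //= expr0 mulr1 big1 ?addr0; first by ring.
by move=> i; rewrite -val_eqE /= => /negPf->; rewrite mulr0n mul0r.
Qed.

End Ideal.

Lemma subring_adjoin R x : is_subring R ->
  is_subring (fun z => exists2 h : {poly E}, forall i, R h`_i & z = h.[x]).
Proof.
move=> Rr; have [R1 RB RM] := Rr; split=> [|a b|a b].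
- exists 1; last by rewrite hornerC.
  by move=> i; rewrite coef1; case: eqP => _ //; apply: subring0.
- move=> [h Rh ->] [h' Rh' ->]; exists (h - h'); last by rewrite hornerD hornerN.
  by move=> i; rewrite coefB; apply: RB.
- move=> [h Rh ->] [h' Rh' ->]; exists (h * h'); last by rewrite hornerM.
  by move=> i; rewrite coefM; apply: subring_sum => // j _; apply: RM.
Qed.

(** Chevalley's theorem: a subring that is maximal among those in which the
    ideal stays proper is a valuation ring, because adjoining an element or
    its inverse must keep the ideal proper. *)
Theorem chevalley R (p s : E) :
  is_subring R -> R p -> R s -> ~ ideal2 R p s 1 ->
  exists V, [/\ is_subring V, forall z, R z -> V z, ~ ideal2 V p s 1
              & forall z, V z \/ V z^-1].
Proof.
move=> Rr Rp Rs R1.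
pose good V := [/\ is_subring V, forall z, R z -> V z & ~ ideal2 V p s 1].
pose T := {V : E -> Prop | good V}.
have t0 : T by exists R; split.
pose le (A B : T) := boolp.asbool (forall z, sval A z -> sval B z).
have leP A B : le A B <-> (forall z, sval A z -> sval B z).
  by split=> [/boolp.asboolP|h] //; apply/boolp.asboolP.
have [|A B C /leP AB /leP BC|C Ctot|[V [Vr RV V1]] Vmax] :=
  @classical_sets.ZL_preorder T t0 le.
- by move=> A; apply/leP.
- by apply/leP => z /AB/BC.
- have [[A0 CA0]|nC] := boolp.pselect (exists A, C A); last first.
    by exists t0 => A CA; case: nC; exists A.
  pose U z := exists2 A, C A & sval A z.
  (* a chain has a member containing any two given elements of its union *)
  have U2 a b : U a -> U b -> exists A, [/\ C A, sval A a & sval A b].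
    move=> [A CA Aa] [B CB Bb]; have [/leP AB|/leP BA] := Ctot _ _ CA CB.
      by exists B; split=> //; apply: AB.
    by exists A; split=> //; apply: BA.
  have Ug : good U.
    split=> [|z Rz|].
    + split=> [|a b Ua Ub|a b Ua Ub].
      * by exists A0 => //; case: (svalP A0) => -[].
      * have [A [CA Aa Ab]] := U2 _ _ Ua Ub; exists A => //.
        by case: (svalP A) => -[_ AB _] _ _; apply: AB.
      * have [A [CA Aa Ab]] := U2 _ _ Ua Ub; exists A => //.
        by case: (svalP A) => -[_ _ AM] _ _; apply: AM.
    + by exists A0 => //; case: (svalP A0) => _ h _; apply: h.
    + move=> [u [v [Uu Uv E1]]]; have [A [CA Au Av]] := U2 _ _ Uu Uv.
      by case: (svalP A) => _ _; apply; exists u, v.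
  by exists (exist _ U Ug) => A CA; apply/leP => z Az; exists A.
exists V; split=> // z.
have Vp := RV _ Rp; have Vs := RV _ Rs; have [V11 VB VM] := Vr.
have [->|z0] := eqVneq z 0; first by left; apply: subring0.
have rel x : ~ V x ->
    exists2 h : {poly E}, forall i, ideal2 V p s h`_i & h.[x] = 1.
  move=> nVx; apply: boolp.contrapT => nh.
  pose W y := exists2 h : {poly E}, forall i, V h`_i & y = h.[x].
  have VW y : V y -> W y.
    move=> Vy; exists y%:P; last by rewrite hornerC.
    by move=> i; rewrite coefC; case: eqP => _ //; apply: subring0.
  have Wg : good W.
    split; [exact: subring_adjoin|by move=> y /RV/VW|].
    move=> [_ [_ [[h Vh ->] [h' Vh' ->] E1]]]; apply: nh.
    exists (p *: h + s *: h'); last by rewrite hornerD !hornerZ -E1.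
    by move=> i; rewrite coefD !coefZ; exists h`_i, h'`_i.
  have /leP /= WV : le (exist _ W Wg) (exist _ V (And3 Vr RV V1)).
    by apply: Vmax; apply/leP.
  apply/nVx/WV; exists 'X; last by rewrite hornerX.
  by move=> i; rewrite coefX; case: eqP => _ //; apply: subring0.
have [Vz|nVz] := boolp.pselect (V z); first by left.
right; apply: boolp.contrapT => nVz1.
have [a Ja az] := rel _ nVz; have [b Jb bz] := rel _ nVz1.
exact: (ideal2_inverse_relations Vr Vp Vs z0 V1 Ja Jb az bz).
Qed.

End ValuationRings.

(** * The place of a valuation ring *)

(** The values form a nonzero subgroup of the integers; dividing by its
    positive generator gives the normalized valuation. *)
Lemma place_of_int_valuation (E : fieldType) (o : E -> int) :
  (forall z w : E, z != 0 -> w != 0 -> o (z * w) = o z + o w) ->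
  (forall z w : E, z != 0 -> w != 0 -> z + w != 0 -> o z <= o w -> o z <= o (z + w)) ->
  (exists2 t : E, t != 0 & 0 < o t) ->
  exists (Q : place E) (d : int), 0 < d /\ forall z : E, z != 0 -> o z = d * ord Q z.
Proof.
move=> oM oD [t0 t0n t0p].
have o1 : o 1 = 0 by have := oM 1 1; rewrite mulr1 oner_neq0 => /(_ isT isT); lia.
have oV z : z != 0 -> o z^-1 = - o z.
  by move=> z0; have := oM z z^-1 z0; rewrite invr_eq0 divff // o1 => /(_ z0); lia.
have oX z n : z != 0 -> o (z ^+ n) = n%:Z * o z.
  move=> z0; elim: n => [|n IH]; first by rewrite expr0 o1 mul0r.
  by rewrite exprS oM ?expf_neq0 // IH; lia.
pose pv n := boolp.asbool (exists t, [/\ t != 0, o t = n%:Z & (0 < n)%N]).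
have expv : exists n, pv n.
  by exists (absz (o t0)); apply/boolp.asboolP; exists t0; split=> //; lia.
case: (ex_minnP expv) => d /boolp.asboolP[t [tn ot d0]] dmin.
have dvd z : z != 0 -> o z = d%:Z * (o z %/ d%:Z)%Z.
  move=> z0; set k := (o z %/ d%:Z)%Z.
  have [r0 rd] : 0 <= (o z %% d%:Z)%Z /\ (o z %% d%:Z)%Z < d%:Z.
    by split; [apply: modz_ge0; lia|apply: ltz_pmod; lia].
  have oE := divz_eq (o z) d%:Z; rewrite -/k in oE.
  have [r_eq0|rn0] := eqVneq (o z %% d%:Z)%Z 0; first by rewrite oE r_eq0; lia.
  have [u [un ou]] : exists u, u != 0 /\ o u = - (k * d%:Z).
    case: k {oE} => k.
      by exists (t ^+ k)^-1; rewrite invr_eq0 oV ?expf_neq0 // oX // ot.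
    by exists (t ^+ k.+1); rewrite expf_neq0 // oX // ot; split=> //; lia.
  suff : pv (absz (o z %% d%:Z)%Z) by move=> /dmin; lia.
  apply/boolp.asboolP; exists (z * u); split; [exact: mulf_neq0| |lia].
  by rewrite oM // ou; lia.
pose v z : \bar int := if z == 0 then +oo%E else (o z %/ d%:Z)%Z%:E.
have vE z : z != 0 -> v z = (o z %/ d%:Z)%Z%:E by rewrite /v => /negPf->.
have v0 : v 0 = +oo%E by rewrite /v eqxx.
have vy z : (v z == +oo)%E = (z == 0) by rewrite /v; case: (z == 0).
have vM z w : v (z * w) = (v z + v w)%E.
  have [->|z0] := eqVneq z 0.
    by rewrite mul0r v0 /v; case: (w == 0).
  have [->|w0] := eqVneq w 0.
    by rewrite mulr0 v0 /v; case: (z == 0).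
  rewrite !vE ?mulf_neq0 // -EFinD; congr (_%:E).
  have h := oM z w z0 w0.
  rewrite (dvd z z0) (dvd w w0) (dvd _ (mulf_neq0 z0 w0)) -mulrDr in h.
  by apply: mulfI h; rewrite eqz_nat -lt0n.
have vle z w : z != 0 -> w != 0 -> (v z <= v w)%E -> o z <= o w.
  by move=> z0 w0; rewrite !vE // lee_fin => h; rewrite (dvd z) // (dvd w) // ler_wpM2l.
have vD z w : (Order.min (v z) (v w) <= v (z + w)%R)%E.
  wlog zw : z w / (v z <= v w)%E.
    move=> W; have /orP[zw|wz] := le_total (v z) (v w); first exact: W.
    by rewrite minC addrC; apply: W.
  rewrite min_l //.
  have [zw0|zwn] := eqVneq (z + w) 0; first by rewrite zw0 v0 leey.
  have [w0|wn] := eqVneq w 0; first by rewrite w0 addr0.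
  have [z0|zn] := eqVneq z 0.
    by move: zw; rewrite z0 v0 leye_eq vy (negPf wn).
  have := oD z w zn wn zwn (vle _ _ zn wn zw).
  by rewrite !vE // lee_fin => h; apply: lez_pdiv2r.
have vn : exists t, v t = 1%E.
  by exists t; rewrite vE // ot divzz; congr (_%:E); case: (d) d0.
exists (Place vy vM vD vn), d; split; first by lia.
by move=> z z0; rewrite /ord /= vE //=; apply: dvd.
Qed.

Section ValuationRingPlace.
Variables (K : fieldType) (L : fieldExtType K) (P : place K) (V : L -> Prop).
Hypotheses (Vr : is_subring V) (Vtot : forall z, V z \/ V z^-1).
Hypotheses (VP : forall z : K, (0 <= P z)%E -> V z%:A)
  (VP' : forall z : K, z != 0 -> (0 < P z)%E -> ~ V (z%:A)^-1).

Definition vunit z : Prop := [/\ z != 0, V z & V z^-1].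

Lemma vunit1 : vunit 1.
Proof. by case: Vr => V1 _ _; split; rewrite ?oner_neq0 ?invr1. Qed.

Lemma vunitV z : vunit z -> vunit z^-1.
Proof. by case=> z0 Vz Vz1; split; rewrite ?invr_eq0 ?invrK. Qed.

Lemma vunitM z w : vunit z -> vunit w -> vunit (z * w).
Proof.
case: Vr => _ _ VM [z0 Vz Vz1] [w0 Vw Vw1].
by split; rewrite ?mulf_neq0 // ?invfM; apply: VM.
Qed.

Lemma vunitX z n : vunit z -> vunit (z ^+ n).
Proof.
move=> zU; elim: n => [|n IH]; first by rewrite expr0; apply: vunit1.
by rewrite exprS; apply: vunitM.
Qed.

(** If u + m and m were both non-units, then so would be their difference u. *)
Lemma vunit_add u m : vunit u -> V m -> ~ V m^-1 -> vunit (u + m).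
Proof.
have [V1 VB VM] := Vr; move=> [u0 Vu Vu1] Vm nVm.
have m0 : m != 0.
  by apply/eqP => m0; apply: nVm; rewrite m0 invr0; apply: subring0.
have um0 : u + m != 0.
  apply/eqP => um; apply: nVm; have -> : m = - u by rewrite (addr0_eq um).
  by rewrite invrN -sub0r; apply: VB => //; apply: subring0.
split=> //; first exact: subringD.
have [wm|mw] := Vtot ((u + m) / m).
  case: nVm; have -> : m^-1 = ((u + m) / m - 1) * u^-1.
    by field; rewrite m0 u0.
  by apply: VM => //; apply: VB.
have -> : (u + m)^-1 = (1 - ((u + m) / m)^-1) * u^-1 by field; rewrite um0 m0 u0.
by apply: VM => //; apply: VB.
Qed.

(** By induction: the next term and the partial sum have different values, and
    the dominant one of them determines the value of the total. *)
Lemma vunit_sum (f : nat -> L) (s : seq nat) : s != [::] -> uniq s ->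
  (forall i, i \in s -> f i != 0) ->
  (forall i j, i \in s -> j \in s -> i != j -> ~ vunit (f i / f j)) ->
  exists2 i, i \in s & vunit ((\sum_(j <- s) f j) / f i).
Proof.
elim: s => // a [|b s] IH _ /= => [_ f0 _|/andP[nas us] f0 fd].
  exists a; first exact: mem_head.
  by rewrite big_seq1 divff; [exact: vunit1|apply: f0; rewrite inE].
have [//|//|i si|i j si sj|k sk kU] := IH.
- by apply: f0; rewrite inE si orbT.
- by apply: fd; rewrite inE ?si ?sj orbT.
rewrite big_cons; set S := \sum_(j <- _) f j in kU *.
have a0 : f a != 0 by apply: f0; rewrite mem_head.
have k0 : f k != 0 by apply: f0; rewrite inE sk orbT.
have ak : a != k by apply: contraNneq nas => ->.
have nU : ~ vunit (f a / f k) by apply: fd; rewrite ?mem_head // inE sk orbT.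
have [Vak|Vka] := Vtot (f a / f k).
  exists k; first by rewrite inE sk orbT.
  rewrite addrC mulrDl; apply: vunit_add => // Vka.
  by apply: nU; split; rewrite ?mulf_neq0 ?invr_eq0.
exists a; first exact: mem_head.
rewrite mulrDl divff //; apply: vunit_add; first exact: vunit1.
  have -> : S / f a = S / f k * (f a / f k)^-1 by field; rewrite a0 k0.
  by case: Vr => _ _; apply=> //; case: kU.
have [S0 _ VS] := kU => Vak; apply: nU; split=> //.
  by rewrite mulf_neq0 ?invr_eq0.
have Sn0 : S != 0 by apply: contraNneq S0 => ->; rewrite mul0r.
have -> : f a / f k = (S / f a)^-1 * (S / f k) by field; rewrite Sn0 a0 k0.
by case: Vr => _ _; apply=> //; case: kU.
Qed.

(** In a relation over K between the powers of z two terms have the same value,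
    for otherwise the relation would have the value of one of its terms. *)
Lemma vunit_pow_base z : z != 0 ->
  exists n c, [/\ (0 < n <= \dim {:L})%N, c != 0 & vunit (z ^+ n / c%:A)].
Proof.
move=> z0; have /polyOver1P[q qE] := minPolyOver 1%AS z.
have qz : (map_poly (in_alg L) q).[z] = 0 by rewrite -qE; apply/rootP/root_minPoly.
have q0 : q != 0.
  by rewrite -(map_poly_eq0 (in_alg L)) -qE monic_neq0 // monic_minPoly.
have sq : (size q <= (\dim {:L}).+1)%N.
  rewrite -(size_map_poly (in_alg L)) -qE size_minPoly ltnS adjoin_degreeE.
  by rewrite dimv1 divn1 dimvS // subvf.
pose f i := (q`_i)%:A * z ^+ i.
pose s := [seq i <- iota 0 (size q) | q`_i != 0].
have sP i : i \in s -> (i < size q)%N /\ q`_i != 0.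
  by rewrite mem_filter mem_iota => /andP[-> /=].
have f0 i : i \in s -> f i != 0.
  by move=> /sP[_ qi]; rewrite mulf_neq0 ?expf_neq0 ?scale_neq0.
have sum0 : \sum_(j <- s) f j = 0.
  rewrite big_filter -[RHS]qz horner_coef size_map_poly.
  rewrite -(big_mkord xpredT (fun i => (map_poly (in_alg L) q)`_i * z ^+ i)).
  rewrite /index_iota subn0 big_mkcond; apply: eq_bigr => i _.
  by rewrite coef_map /f /=; case: eqP => //= ->; rewrite scale0r mul0r.
have [i [j [si sj ij fU]]] : exists i j, [/\ i \in s, j \in s, (j < i)%N & vunit (f i / f j)].
  apply: boolp.contrapT => nU.
  have [||//|i j si sj ij fU|i si] := @vunit_sum f s.
  - rewrite -size_eq0 -lt0n -has_predT; apply/hasP; exists (size q).-1 => //.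
    by rewrite mem_filter -/(lead_coef q) lead_coef_eq0 q0 mem_iota ltn_predL lt0n size_poly_eq0.
  - by rewrite filter_uniq // iota_uniq.
  - apply: nU; case: (ltngtP i j) => [lij|lij|eij].
    + by exists j, i; split=> //; have := vunitV fU; rewrite invf_div.
    + by exists i, j.
    + by rewrite eij eqxx in ij.
  - by rewrite sum0 mul0r; case; rewrite eqxx.
have [[li qi] [lj qj]] := (sP i si, sP j sj).
exists (i - j)%N, (q`_j / q`_i); split.
- by rewrite subn_gt0 ij; apply: leq_trans (leq_subr _ _) _; rewrite -ltnS (leq_trans li).
- by rewrite mulf_neq0 ?invr_eq0.
suff -> : z ^+ (i - j) / (q`_j / q`_i)%:A = f i / f j by [].
have qi' := @scale_neq0 _ L _ qi; have qj' := @scale_neq0 _ L _ qj.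
have -> : (q`_j / q`_i)%:A = (q`_j)%:A / (q`_i)%:A :> L.
  by rewrite -[LHS]/(in_alg L _) rmorphM fmorphV.
have zj : z ^+ j != 0 by rewrite expf_neq0.
have zi : z ^+ i = z ^+ (i - j) * z ^+ j by rewrite -exprD subnK // ltnW.
rewrite /f zi; field.
by rewrite qi' qj' zj.
Qed.

Lemma vunit_base_ord c : c != 0 -> vunit c%:A -> ord P c = 0.
Proof.
move=> c0 [_ Vc Vc1].
have := VP' c0; have := @VP' c^-1; rewrite valV // invr_eq0 ordE // !lte_fin.
have -> : ((c^-1)%:A)^-1 = c%:A :> L.
  by rewrite -[(c^-1)%:A]/(in_alg L _) fmorphV invrK.
move=> h1 h2; apply/eqP; have [lt|lt|//] := ltgtP (ord P c) 0.
  by case: (h1 c0 _ Vc); rewrite oppr_gt0.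
by case: (h2 lt Vc1).
Qed.

(** A suitable power of each element differs from an element of K by a unit
    of V, which yields a valuation with integral values. *)
Lemma place_of_valuation_ring :
  exists Q : place L, forall z, (0 <= Q z)%E <-> V z.
Proof.
have [V1 VB VM] := Vr.
(* a multiple of all the exponents provided by vunit_pow_base *)
pose N := (\dim {:L})`!.
have N0 : (0 < N)%N by apply: fact_gt0.
have /boolp.choice[c cP] z : exists c : K,
    z != 0 -> c != 0 /\ vunit (z ^+ N / c%:A).
  have [->|z0] := eqVneq z 0; first by exists 0.
  have [n [c [/andP[n0 nd] c0 cU]]] := vunit_pow_base z0.
  have /dvdnP[k Nk] : (n %| N)%N by rewrite dvdn_fact // n0.
  exists (c ^+ k) => _; rewrite expf_neq0 //; split=> //.
  have -> : (c ^+ k)%:A = (c%:A) ^+ k :> L by rewrite -[LHS]/(in_alg L _) rmorphXn.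
  by rewrite Nk mulnC exprM -expr_div_n; apply: vunitX.
pose o z := ord P (c z).
have oE z c' : z != 0 -> c' != 0 -> vunit (z ^+ N / c'%:A) -> o z = ord P c'.
  move=> z0 c'0 c'U; have [cz0 cU] := cP z z0.
  have h : vunit (c' / c z)%:A.
    rewrite (_ : _%:A = (z ^+ N / (c z)%:A) / (z ^+ N / c'%:A)).
      exact: vunitM (vunitV _).
    have a := @scale_neq0 _ L _ cz0; have b := @scale_neq0 _ L _ c'0.
    have -> : (c' / c z)%:A = c'%:A / (c z)%:A :> L.
      by rewrite -[LHS]/(in_alg L _) rmorphM fmorphV.
    by field; rewrite a b expf_neq0.
  have := vunit_base_ord _ h; rewrite mulf_neq0 ?invr_eq0 // => /(_ isT).
  rewrite ordM ?invr_eq0 // ordV // /o.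
  by move: (ord P c') (ord P (c z)) => m n; clear; lia.
have oM z w : z != 0 -> w != 0 -> o (z * w) = o z + o w.
  move=> z0 w0; have [cz czU] := cP z z0; have [cw cwU] := cP w w0.
  rewrite (oE _ (c z * c w)) ?mulf_neq0 ?ordM //.
  rewrite exprMn algM invfM mulrACA; exact: vunitM.
have o_ge0 z : z != 0 -> 0 <= o z <-> V z.
  move=> z0; have [cz [_ Vzc Vzc1]] := cP z z0.
  have czA := @scale_neq0 _ L _ cz.
  have zN : z ^+ N = z ^+ N / (c z)%:A * (c z)%:A by rewrite divfK.
  split=> [oz|Vz].
    have VzN : V (z ^+ N) by rewrite zN; apply: VM => //; apply: VP; rewrite ordE.
    have [//|Vz1] := Vtot z.
    have -> : z = (z^-1) ^+ N.-1 * z ^+ N.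
      rewrite exprVn -{2}(prednK N0) exprS mulrC mulfK // expf_neq0 //.
    by apply: VM => //; apply: subringX.
  have Vc : V (c z)%:A.
    have -> : (c z)%:A = (z ^+ N / (c z)%:A)^-1 * z ^+ N.
      by field; rewrite czA expf_neq0.
    by apply: VM => //; apply: subringX.
  rewrite leNgt; apply/negP => lt; have := @VP' (c z)^-1.
  rewrite invr_eq0 valV // lte_fin oppr_gt0 => /(_ cz lt); apply.
  by rewrite -[(_^-1)%:A]/(in_alg L _) fmorphV invrK.
have oV z : z != 0 -> o z^-1 = - o z.
  move=> z0; have := oM z z^-1 z0; rewrite invr_eq0 divff // => /(_ z0).
  have := oM 1 1; rewrite mulr1 oner_neq0 => /(_ isT isT).
  by move: (o 1) (o z) (o _) => k m n; clear; lia.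
have [z w z0 w0 zw0 le||Q [d [d0 Qd]]] := @place_of_int_valuation L o oM.
- have : 0 <= o (w / z).
    by rewrite oM ?invr_eq0 // oV // subr_ge0.
  rewrite o_ge0 ?mulf_neq0 ?invr_eq0 // => Vwz.
  have : V ((z + w) / z) by rewrite mulrDl divff //; apply: subringD.
  by rewrite -o_ge0 ?mulf_neq0 ?invr_eq0 // oM ?invr_eq0 // oV // subr_ge0.
- have [t t1] := val_of_normal P; have t0 := val_neq0 t1.
  exists t%:A; first exact: scale_neq0.
  rewrite (oE _ (t ^+ N)) ?expf_neq0 ?scale_neq0 //.
    by rewrite ordX // (ord_val t1); lia.
  rewrite (_ : (t ^+ N)%:A = (t%:A) ^+ N).
    by rewrite divff ?expf_neq0 ?scale_neq0 //; apply: vunit1.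
  by rewrite -[LHS]/(in_alg L _) rmorphXn.
exists Q => z; have [->|z0] := eqVneq z 0.
  by rewrite val0; split=> // _; apply: subring0.
by rewrite -o_ge0 // ordE // lee_fin Qd // pmulr_rge0.
Qed.

End ValuationRingPlace.

(** The valuation ring given by Chevalley's theorem makes t and s non-units,
    so that it lies over that of P and has s in its maximal ideal. *)
Theorem exists_place_above (K : fieldType) (L : fieldExtType K) (P : place K)
    (R : L -> Prop) (t : K) (s : L) :
  is_subring R -> (forall z : K, (0 <= P z)%E -> R z%:A) ->
  P t = 1%E -> R s -> ~ ideal2 R t%:A s 1 ->
  exists Q : place L, lies_above Q P /\ (0 < Q s)%E.
Proof.
move=> Rr RP t1 Rs R1; have t0 := val_neq0 t1.
have Rt : R t%:A by apply: RP; rewrite t1.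
have [V [Vr RV V1 Vtot]] := chevalley Rr Rt Rs R1.
have [V11 VB VM] := Vr.
have V0 := subring0 Vr.
have nVs : s != 0 -> ~ V s^-1.
  by move=> s0 Vs; apply: V1; exists 0, s^-1; split=> //; rewrite mulr0 add0r divff.
have VP (z : K) : (0 <= P z)%E -> V z%:A by move=> /RP/RV.
have VP' (z : K) : z != 0 -> (0 < P z)%E -> ~ V (z%:A)^-1.
  move=> z0 Pz Vz; apply: V1; exists ((z / t)%:A * (z%:A)^-1), 0; split=> //.
    apply: VM => //; apply: VP; rewrite val_ofM valV // (ord_val t1).
    by move: Pz; rewrite ordE // -EFinD lte_fin lee_fin; lia.
  rewrite mulr0 addr0 mulrA -algM mulrCA divff // mulr1 divff //.
  exact: scale_neq0.
have [Q QV] := place_of_valuation_ring Vr Vtot VP VP'.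
have Qgt0 z : V z -> (z != 0 -> ~ V z^-1) -> (0 < Q z)%E.
  move=> Vz nVz; have [->|z0] := eqVneq z 0; first by rewrite val0.
  have := nVz z0; rewrite -!QV valV // ordE // lee_fin lte_fin.
  by move: (ord Q z) => n h; rewrite ltNge; apply/negP => n0; apply: h; rewrite oppr_ge0.
exists Q; split; last by apply: Qgt0 => //; apply: RV.
move=> z Pz; apply: Qgt0; first exact/VP/ltW.
move=> zA0; apply: VP' => //; apply: contraNneq zA0 => ->.
by rewrite scale0r.
Qed.

Corollary exists_place (K : fieldType) (L : fieldExtType K) (P : place K) :
  exists Q : place L, lies_above Q P.
Proof.
have [t t1] := val_of_normal P.
pose R (z : L) := exists2 c : K, (0 <= P c)%E & z = c%:A.
have Rr : is_subring R.
  split=> [|_ _ [a Pa ->] [b Pb ->]|_ _ [a Pa ->] [b Pb ->]].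
  - by exists 1; rewrite ?val1 ?scale1r.
  - by exists (a - b); rewrite ?val_sub_ge // scalerBl.
  - by exists (a * b); rewrite ?val_mul_ge0 // algM.
have R0 : R 0 by exists 0; rewrite ?val0 ?scale0r.
have [||Q [QP _]] := exists_place_above Rr _ t1 R0; last by exists Q.
  by move=> z Pz; exists z.
move=> [_ [_ [[u Pu ->] [v _ ->] E1]]].
have : (0 < P (t * u)%R)%E by apply: val_mul_gt0; rewrite ?t1.
suff -> : t * u = 1 by rewrite val1 ltxx.
apply: (fmorph_inj (in_alg L)); rewrite rmorph1 E1 mul0r addr0.
by rewrite -[LHS]/((t * u)%:A) algM.
Qed.

(** * Cubic extensions *)

Section Cubic.
Variables (K : fieldType) (L : fieldExtType K) (P : place K).
Hypothesis dim3 : \dim {:L} = 3%N.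
Implicit Types (Q : place L).

Lemma alg_in1 (z : K) : z%:A \in (1%VS : {vspace L}).
Proof. by rewrite rpredZ // rpred1. Qed.

(** The degree is prime, so the minimal polynomial has degree 3. *)
Lemma cubic_free s (c0 c1 c2 : K) : s \notin (1%VS : {vspace L}) ->
  c0%:A + c1%:A * s + c2%:A * s ^+ 2 = 0 -> [/\ c0 = 0, c1 = 0 & c2 = 0].
Proof.
move=> s1 rel; have deg3 : adjoin_degree 1%AS s = 3%N.
  have : (adjoin_degree 1%AS s %| 3)%N.
    have := field_dimS (subvf <<1; s>>%AS).
    by rewrite dim3 dim_Fadjoin dimv1 muln1.
  rewrite dvdn_divisors // => h; have : adjoin_degree 1%AS s != 1%N.
    by rewrite adjoin_deg_eq1.
  by move: h; rewrite !inE => /orP[/eqP->|/eqP].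
pose p : {poly L} := Poly [:: c0%:A; c1%:A; c2%:A].
have p0 : p = 0.
  apply/eqP; rewrite -(@root_small_adjoin_poly _ _ 1%AS s).
  - apply/rootP; rewrite horner_Poly /= mul0r add0r -[RHS]rel; ring.
  - apply/polyOverP => i; rewrite coef_Poly.
    by case: i => [|[|[|i]]] /=; rewrite ?alg_in1 // nth_nil rpred0.
  - by rewrite deg3; apply: size_Poly.
have cE i : [:: c0%:A; c1%:A; c2%:A]`_i = 0 :> L by rewrite -coef_Poly -/p p0 coef0.
by split; apply: alg_inj; rewrite alg0; [exact: (cE 0%N)|exact: (cE 1%N)|exact: (cE 2%N)].
Qed.

(** The ring O + O s + O s^2 over the valuation ring O of P; the ideal that
    P and s generate in it is proper, as the constant coefficients of its
    elements have positive valuation. *)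
Lemma cubic_place s (c0 c1 c2 : K) : s \notin (1%VS : {vspace L}) ->
  s ^+ 3 = c0%:A + c1%:A * s + c2%:A * s ^+ 2 ->
  (0 < P c0)%E -> (0 <= P c1)%E -> (0 <= P c2)%E ->
  exists Q, lies_above Q P /\ (0 < Q s)%E.
Proof.
move=> s1 s3 Pc0 Pc1 Pc2; have [t t1] := val_of_normal P.
have Pc0' := ltW Pc0.
have PD z w : (0 <= P z)%E -> (0 <= P w)%E -> (0 <= P (z + w)%R)%E by apply: val_add_ge.
have PM z w : (0 <= P z)%E -> (0 <= P w)%E -> (0 <= P (z * w)%R)%E.
  exact: val_mul_ge0.
have P0 : (0 <= P 0%R)%E by rewrite val0.
have P1 : (0 <= P 1%R)%E by rewrite val1.
pose R z := exists a0 a1 a2, [/\ (0 <= P a0)%E, (0 <= P a1)%E, (0 <= P a2)%E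
  & z = a0%:A + a1%:A * s + a2%:A * s ^+ 2].
have Rr : is_subring R.
  split=> [|_ _ [a0 [a1 [a2 [a0P a1P a2P ->]]]] [b0 [b1 [b2 [b0P b1P b2P ->]]]]
           |_ _ [a0 [a1 [a2 [a0P a1P a2P ->]]]] [b0 [b1 [b2 [b0P b1P b2P ->]]]]].
  - by exists 1, 0, 0; split=> //; rewrite !algE; ring.
  - exists (a0 - b0), (a1 - b1), (a2 - b2).
    by split; try exact: val_sub_ge; rewrite !algE; ring.
  - pose d3 := a1 * b2 + a2 * b1; pose d4 := a2 * b2.
    exists (a0 * b0 + d3 * c0 + d4 * (c2 * c0)),
      (a0 * b1 + a1 * b0 + d3 * c1 + d4 * (c0 + c2 * c1)),
      (a0 * b2 + a1 * b1 + a2 * b0 + d3 * c2 + d4 * (c1 + c2 * c2)).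
    rewrite /d3 /d4; split; last by rewrite !algE; ring: s3.
    all: repeat first [assumption | apply PD | apply PM].
have RP (z : K) : (0 <= P z)%E -> R z%:A.
  by move=> Pz; exists z, 0, 0; split=> //; rewrite !algE; ring.
have Rs : R s by exists 0, 1, 0; split=> //; rewrite !algE; ring.
apply: (exists_place_above Rr RP t1 Rs).
move=> [_ [_ [[a0 [a1 [a2 [a0P _ _ ->]]]] [b0 [b1 [b2 [_ _ b2P ->]]]] E1]]].
have [h _ _] : [/\ t * a0 + b2 * c0 - 1 = 0, t * a1 + b0 + b2 * c1 = 0
     & t * a2 + b1 + b2 * c2 = 0].
  apply: (cubic_free s1); move/eqP: E1; rewrite eq_sym -subr_eq0 => /eqP E1.
  by rewrite -[RHS]E1 !algE; ring: s3.
have : (0 < P 1%R)%E.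
  have -> : 1 = t * a0 + b2 * c0 by apply/eqP; rewrite eq_sym -subr_eq0 h.
  apply: val_add_gt; first by apply: val_mul_gt0 => //; rewrite t1.
  by rewrite mulrC; apply: val_mul_gt0.
by rewrite val1 ltxx.
Qed.

End Cubic.

Section CubicSignatures.
Variables (K : fieldType) (L : fieldExtType K) (P : place K).
Hypothesis dim3 : \dim {:L} = 3%N.
Implicit Types (Q : place L).

Lemma lies_above_ge0 Q (z : K) : lies_above Q P -> (0 <= P z)%E -> (0 <= Q z%:A)%E.
Proof. by move=> /lies_above_ramified[e [e0 Qe]]; rewrite (ramification_ge0 _ Qe). Qed.

Lemma lies_above_gt0 Q (z : K) : lies_above Q P -> (0 < Q z%:A)%E = (0 < P z)%E.
Proof. by move=> /lies_above_ramified[e [e0 Qe]]; rewrite (ramification_gt0 _ Qe). Qed.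

Lemma cubic_signature (ef : seq (nat *l nat)) (Q : 'I_(size ef) -> place L) :
  let e (i : 'I_(size ef)) := (nth (0, 0)%N ef i).1 in
  let f (i : 'I_(size ef)) := (nth (0, 0)%N ef i).2 in
  (forall i j, Q i =1 Q j -> i = j) ->
  (forall i, lies_above (Q i) P) ->
  (forall i E, (0 < E)%N -> ramification_index (Q i) P E -> (e i <= E)%N) ->
  all (fun p => (0 < p.1)%N && (0 < p.2)%N) ef ->
  (forall i, exists b : 'I_(f i) -> L, residue_free P (Q i) b) ->
  (\sum_(p <- ef) p.1 * p.2 = 3)%N ->
  sorted <=%O ef ->
  signature L P (flatten [seq [:: p.1; p.2] | p <- ef]).
Proof.
move=> e f Qinj QP Qe ef0 Qf sum3 efs.
have efE : [seq (e i, f i) : nat *l nat | i <- enum 'I_(size ef)] = ef.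
  rewrite -[RHS](mkseq_nth (0, 0)%N) /mkseq -val_enum_ord -map_comp.
  by apply: eq_map => i; rewrite /e /f /=; case: (nth _ _ _).
have := @signature_of_lower_bounds _ _ _ _ Q e f Qinj QP Qe.
rewrite efE; apply=> //.
  by move=> i; apply/andP; apply: (allP ef0 _ (mem_nth _ (ltn_ord i))).
by rewrite dim3 -sum3 (big_nth (0, 0)%N) big_mkord.
Qed.

(** Once b is a unit, a + b t = 0 in the residue field gives t = - a / b. *)
Lemma residue_free2 Q t : lies_above Q P -> (0 <= Q t)%E ->
  (forall c : K, (0 <= P c)%E -> ~ (0 < Q (t - c%:A)%R)%E) ->
  forall a b : K, (0 <= P a)%E -> (0 <= P b)%E ->
    (0 < Q (a%:A + b%:A * t)%R)%E -> (0 < P a)%E /\ (0 < P b)%E.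
Proof.
move=> QP t0 nt a b Pa Pb Qab.
have Pb0 : (0 < P b)%E.
  rewrite lt_def Pb andbT; apply/eqP => Pb0; have bn0 := val_neq0 Pb0.
  have bV : P b^-1 = 0%E by rewrite valV // (ord_val Pb0) oppr0.
  apply: (nt (- (a / b))); first by rewrite valN val_mul_ge0 ?bV.
  have bA := @scale_neq0 _ L _ bn0.
  have -> : t - (- (a / b))%:A = (a%:A + b%:A * t) * (b^-1)%:A.
    by rewrite !algE; field.
  by apply: val_mul_gt0 => //; apply: lies_above_ge0 => //; rewrite bV.
split=> //; rewrite -(lies_above_gt0 _ QP) -(addrK (b%:A * t) a%:A).
by apply: val_sub_gt => //; apply: val_mul_gt0; rewrite ?lies_above_gt0.
Qed.

Lemma residue_free2_basis Q t : lies_above Q P -> (0 <= Q t)%E ->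
  (forall c : K, (0 <= P c)%E -> ~ (0 < Q (t - c%:A)%R)%E) ->
  exists b : 'I_2 -> L, residue_free P Q b.
Proof.
move=> QP t0 nt; exists (fun i => [:: 1; t]`_i); split=> [[[|[|]]] //= _|c c0].
  by rewrite val1.
rewrite !big_ord_recl big_ord0 /= addr0 -[c (lift _ _) *: t]mulr_algl.
move=> /(residue_free2 QP t0 nt)[] // h0 h1 i.
by case: (unliftP ord0 i) => [j ->|->] //; rewrite (ord1 j).
Qed.

(** In the residue field, t is a root of an irreducible cubic: were t^2 equal
    to u t + v, the division of T^3 - a T + b by T^2 - u T - v would leave
    either a linear relation for t or the root - u. *)
Lemma residue_free3_basis Q t (a b : K) : lies_above Q P ->
  t ^+ 3 - a%:A * t + b%:A = 0 -> (0 <= P a)%E -> (0 <= P b)%E -> (0 <= Q t)%E ->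
  (forall c : K, (0 <= P c)%E -> ~ (0 < P (c ^+ 3 - a * c + b)%R)%E) ->
  exists b : 'I_3 -> L, residue_free P Q b.
Proof.
move=> QP rel Pa Pb t0 nroot.
have Qa := lies_above_ge0 QP Pa; have Qb := lies_above_ge0 QP Pb.
have t3 : t ^+ 3 = a%:A * t - b%:A.
  by apply/eqP; rewrite -subr_eq0 -[X in _ == X]rel; apply/eqP; ring.
have nt (c : K) : (0 <= P c)%E -> ~ (0 < Q (t - c%:A)%R)%E.
  move=> Pc Qtc; apply: (nroot c Pc); rewrite -(lies_above_gt0 _ QP).
  have -> : (c ^+ 3 - a * c + b)%:A =
      - ((t - c%:A) * (t ^+ 2 + t * c%:A + c%:A ^+ 2 - a%:A)).
    by rewrite !algE; ring: t3.
  rewrite valN; apply: val_mul_gt0 => //; have Qc := lies_above_ge0 QP Pc.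
  by apply: val_sub_ge => //; do ![apply: val_add_ge]; rewrite ?expr2 val_mul_ge0.
have free2 := residue_free2 QP t0 nt.
exists (fun i => [:: 1; t; t ^+ 2]`_i); split=> [[[|[|[|]]]] //= _|c c0].
- by rewrite val1.
- by rewrite expr2 val_mul_ge0.
rewrite !big_ord_recl big_ord0 /= addr0 -[c _ *: t]mulr_algl -[c _ *: t ^+ 2]mulr_algl.
set c00 := c ord0; set c1 := c (lift ord0 ord0); set c2 := c (lift _ (lift _ _)).
have Pc00 : (0 <= P c00)%E := c0 _; have Pc1 : (0 <= P c1)%E := c0 _.
move=> Qc.
have P2 : (0 < P c2)%E.
  rewrite lt_def c0 andbT; apply/eqP => Pc2; have c2n0 := val_neq0 Pc2.
  have c2V : P c2^-1 = 0%E by rewrite valV // (ord_val Pc2) oppr0.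
  pose u := - (c1 / c2); pose v := - (c00 / c2).
  have Pu : (0 <= P u)%E by rewrite valN val_mul_ge0 ?c2V.
  have Pv : (0 <= P v)%E by rewrite valN val_mul_ge0 ?c2V.
  have c2A := @scale_neq0 _ L _ c2n0.
  have Qt2 : (0 < Q (t ^+ 2 - u%:A * t - v%:A)%R)%E.
    have -> : t ^+ 2 - u%:A * t - v%:A = 
        (c00%:A + (c1%:A * t + c2%:A * t ^+ 2)) * (c2^-1)%:A.
      by rewrite /u /v !algE; field.
    by apply: val_mul_gt0 => //; apply: lies_above_ge0 => //; rewrite c2V.
  have [] := free2 (- (u * v) - b) (a - (u ^+ 2 + v)).
  - by apply: val_sub_ge => //; rewrite valN val_mul_ge0.
  - by apply: val_sub_ge => //; apply: val_add_ge => //; rewrite expr2 val_mul_ge0.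
  - have -> : (- (u * v) - b)%:A + (a - (u ^+ 2 + v))%:A * t =
        (t ^+ 2 - u%:A * t - v%:A) * (t + u%:A).
      by rewrite !algE; ring: t3.
    by apply: val_mul_gt0 => //; apply: val_add_ge => //; apply: lies_above_ge0.
  move=> h1 h2; apply: (nroot (- u)); first by rewrite valN.
  have -> : (- u) ^+ 3 - a * - u + b =
     (a - (u ^+ 2 + v)) * u - (- (u * v) - b) by ring.
  by apply: val_sub_gt => //; apply: val_mul_gt0.
have [|P0 P1] := free2 c00 c1 (c0 _) (c0 _).
  have -> : c00%:A + c1%:A * t =
      c00%:A + (c1%:A * t + c2%:A * t ^+ 2) - c2%:A * t ^+ 2 by ring.
  apply: val_sub_gt => //.
  by apply: val_mul_gt0; rewrite ?lies_above_gt0 // expr2 val_mul_ge0.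
by move=> i; case: (unliftP ord0 i) => [j ->|->] //;
  case: (unliftP ord0 j) => [k ->|->] //; rewrite (ord1 k).
Qed.

End CubicSignatures.

Section CubicCases.
Variables (K : fieldType) (L : fieldExtType K) (P : place K).
Hypothesis dim3 : \dim {:L} = 3%N.
Variables (A B : K) (y : L).
Hypotheses (y1 : y \notin (1%VS : {vspace L}))
  (yrel : y ^+ 3 - A%:A * y + B%:A = 0).
Implicit Types (Q : place L).

Let y3 : y ^+ 3 = A%:A * y - B%:A.
Proof. by apply/eqP; rewrite -subr_eq0 -[X in _ == X]yrel; apply/eqP; ring. Qed.

Lemma cubic_in1 (c0 c1 c2 : K) :
  c0%:A + c1%:A * y + c2%:A * y ^+ 2 \in (1%VS : {vspace L}) -> c1 = 0 /\ c2 = 0.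
Proof.
move=> /vlineP[k kE]; have [] // := @cubic_free _ _ dim3 y (c0 - k) c1 c2 y1.
move/eqP: kE; rewrite -subr_eq0 => /eqP <-.
by rewrite !algE; ring.
Qed.

(** The relation for y reduces to T^3 - T = 0, and for each of the roots
    rho = 0, 1, -1 the norm of y - rho has positive valuation. *)
Lemma signature_split_unit : (0 < P (A - 1)%R)%E -> (0 < P B)%E -> P 2 = 0%E ->
  signature L P [:: 1; 1; 1; 1; 1; 1]%N.
Proof.
move=> PA1 PB P2; have P1 := val1 P.
pose rho (i : 'I_3) : K := [:: 0; 1; -1]`_i.
have rho3 i : rho i ^+ 3 = rho i.
  by case: i => [[|[|[|]]]] // ?; rewrite /rho /=; ring.
have rho0 i : (0 <= P (rho i))%E.
  by case: i => [[|[|[|]]]] // ?; rewrite /rho /= ?val0 ?valN ?P1.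
have rho_inj i j : (0 < P (rho i - rho j)%R)%E -> i = j.
  have P11 : P (1 + 1) = 0%E by rewrite -P2.
  case: i j => [[|[|[|]]] // i3] [[|[|[|]]] // j3]; rewrite /rho /=;
    rewrite ?subr0 ?sub0r ?opprK -?opprD ?valN ?P1 ?P11 ?ltxx // => _;
    exact: val_inj.
have /boolp.choice[Q QP] (i : 'I_3) : exists Q, lies_above Q P /\
    (0 < Q (y - (rho i)%:A)%R)%E.
  have r3A : (rho i)%:A ^+ 3 = (rho i)%:A :> L by rewrite -algX rho3.
  have PA0 : (0 <= P A)%E.
    by rewrite -(subrK 1 A) val_add_ge ?P1 // ltW.
  have r2 : (0 <= P (rho i ^+ 2)%R)%E by rewrite expr2 val_mul_ge0.
  apply: (@cubic_place _ _ P dim3 _ (rho i * (A - 1) - B)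
    (A - (rho i ^+ 2 + rho i ^+ 2 + rho i ^+ 2)) (- (rho i + rho i + rho i))).
  - apply/negP => h; have [] := @cubic_in1 (- rho i) 1 0; last first.
      by move/eqP; rewrite oner_eq0.
    by rewrite !algE (_ : _ + _ = y - (rho i)%:A) //; ring.
  - by rewrite !algE; ring: y3 r3A.
  - by apply: val_sub_gt => //; rewrite mulrC val_mul_gt0.
  - by apply: val_sub_ge => //; do ![apply: val_add_ge].
  - by rewrite valN; do ![apply: val_add_ge].
apply: (@cubic_signature _ _ P dim3 [:: (1, 1); (1, 1); (1, 1)]%N Q) => //.
- move=> i j Qij; apply: rho_inj; rewrite -(lies_above_gt0 _ (QP i).1).
  have -> : (rho i - rho j)%:A = (y - (rho j)%:A) - (y - (rho i)%:A).
    by rewrite !algE; ring.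
  by apply: val_sub_gt; rewrite ?(QP i).2 // Qij (QP j).2.
- by move=> i; case: (QP i).
- by case=> [[|[|[|]]]].
- by case=> [[|[|[|]]]] // i3; apply: residue_free1; case: (QP (Ordinal i3)).
- by rewrite !big_cons big_nil.
Qed.

(** The element w = y^2 / A satisfies w (w - 1)^2 = B^2 / A^3, so that its
    image in each residue field is 0 or 1; as both w and w - 1 have norms of
    positive valuation, both cases occur. *)
Lemma two_places : (3%:E * P A < 2%:E * P B)%E ->
  exists Q1 Q2, [/\ lies_above Q1 P, lies_above Q2 P,
    (0 < Q1 ((A^-1)%:A * y ^+ 2)%R)%E & (0 < Q2 ((A^-1)%:A * y ^+ 2 - 1)%R)%E].
Proof.
move=> PAB; have A0 : A != 0.
  by apply: contraTneq PAB => ->; rewrite val0 gt0_muley // -leNgt leey.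
have aA : (A^-1)%:A * A%:A = 1 :> L by rewrite -algM mulVf // alg1.
pose w := (A^-1)%:A * y ^+ 2; pose eps := B ^+ 2 / A ^+ 3.
have Peps : (0 < P eps)%E.
  rewrite /eps; have [->|B0] := eqVneq B 0; first by rewrite expr0n mul0r val0.
  rewrite ordE ?mulf_neq0 ?invr_eq0 ?expf_neq0 // lte_fin.
  rewrite ordM ?invr_eq0 ?expf_neq0 // ordV ?expf_neq0 // !ordX //.
  by move: PAB; rewrite !ordE // -!EFinM lte_fin subr_gt0.
have w1 (k : K) : w - k%:A \notin (1%VS : {vspace L}).
  apply/negP => h; have [] := @cubic_in1 (- k) 0 A^-1; last first.
    by move=> _ /eqP; rewrite invr_eq0 (negPf A0).
  by rewrite !algE (_ : _ + _ = w - k%:A) // /w !algE; ring.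
have epsE : eps%:A = B%:A ^+ 2 * (A^-1)%:A ^+ 3 :> L by rewrite /eps !algE exprVn.
have P1 : P 1 = 0%E by apply: val1.
have [|||||Q1 [Q1P Q1w]] := @cubic_place _ _ P dim3 w eps (- 1) (1 + 1).
- by have := w1 0; rewrite alg0 subr0.
- by rewrite algD epsE !algN alg1 /w; ring: aA y3.
- by [].
- by rewrite valN P1.
- by rewrite val_add_ge ?P1.
have [|||||Q2 [Q2P Q2w]] := @cubic_place _ _ P dim3 (w - 1) eps 0 (- 1).
- by have := w1 1; rewrite alg1.
- by rewrite epsE algN alg1 alg0 /w; ring: aA y3.
- by [].
- by rewrite val0.
- by rewrite valN P1.
by exists Q1, Q2.
Qed.

Lemma two_places_neq Q1 Q2 w : (0 < Q1 w)%E -> (0 < Q2 (w - 1)%R)%E -> ~ Q1 =1 Q2.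
Proof.
move=> h1 h2 h; have : (0 < Q2 (w - (w - 1))%R)%E.
  by apply: val_sub_gt => //; rewrite -h.
by rewrite subKr val1 ltxx.
Qed.

Lemma two_places_signature Q1 Q2 e f :
  lies_above Q1 P -> lies_above Q2 P -> ~ Q1 =1 Q2 ->
  (forall E, (0 < E)%N -> ramification_index Q2 P E -> (e <= E)%N) ->
  (exists b : 'I_f -> L, residue_free P Q2 b) ->
  (0 < e)%N -> (0 < f)%N -> (e * f = 2)%N ->
  signature L P [:: 1; 1; e; f]%N.
Proof.
move=> Q1P Q2P Q12 Qe Qf e0 f0 ef2.
apply: (@cubic_signature _ _ P dim3 [:: (1, 1); (e, f)]%N
  (fun i => nth Q1 [:: Q1; Q2] i)).
- case=> [[|[|i]] i2]; case=> [[|[|j]] j2] //= h; try exact: val_inj.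
  by case: Q12 => z; rewrite h.
- by case=> [[|[|]]].
- by case=> [[|[|]]] // i2 E E0; apply: Qe.
- by rewrite /= e0 f0.
- by case=> [[|[|]]] // i2; apply: residue_free1.
- by rewrite !big_cons big_nil /= addn0 ef2.
- by case: e f e0 f0 {Qe Qf ef2} => [|[|e]] [|[|f]].
Qed.

(** Where w is a unit, twice the valuation of y is that of A, which is an odd
    multiple of the ramification index. *)
Lemma signature_ramified k : (3%:E * P A < 2%:E * P B)%E -> P A = (2 * k + 1)%:E ->
  signature L P [:: 1; 1; 2; 1]%N.
Proof.
move=> PAB PA; have [Q1 [Q2 [Q1P Q2P Q1w Q2w]]] := two_places PAB.
apply: (two_places_signature Q1P Q2P (two_places_neq Q1w Q2w)) => //; last first.
  exact: residue_free1.
move=> E E0 QE; have A0 := val_neq0 PA.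
have wU : Q2 ((A^-1)%:A * y ^+ 2) = 0%E.
  by apply: val_eq0_sub Q2w; apply: val1.
have y0 : y != 0 by apply: contraNneq y1 => ->; rewrite mem0v.
have := ord_val wU; rewrite ordM ?expf_neq0 ?scale_neq0 ?invr_eq0 // ordX //.
rewrite (val_ramified QE) ?invr_eq0 // ordV // (ord_val PA).
case: E E0 {QE} => [|[|E]] // _; move: (ord Q2 y) => n; clear; lia.
Qed.

(** Where w = 1 modulo the place, y divided by an element of valuation k
    reduces to a square root of a residue class which is not a square in the
    residue field of P. *)
Lemma signature_inert k :
  (3%:E * P A < 2%:E * P B)%E -> P A = (2 * k)%:E ->
  (forall c, ~ (P A < P (A - c ^+ 2)%R)%E) ->
  signature L P [:: 1; 1; 1; 2]%N.
Proof.
move=> PAB PA nsq; have [Q1 [Q2 [Q1P Q2P Q1w Q2w]]] := two_places PAB.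
apply: (two_places_signature Q1P Q2P (two_places_neq Q1w Q2w)) => //.
have A0 := val_neq0 PA.
have y0 : y != 0 by apply: contraNneq y1 => ->; rewrite mem0v.
have wU : Q2 ((A^-1)%:A * y ^+ 2) = 0%E.
  by apply: val_eq0_sub Q2w; apply: val1.
have [E [E0 QE]] := lies_above_ramified Q2P.
have [p p1] := val_of_normal P; have p0 := val_neq0 p1.
pose d := p ^ k; have d0 : d != 0 by rewrite expfz_neq0.
have Pd : P d = k%:E by rewrite valXz // (ord_val p1) mulr1.
have dA0 := @scale_neq0 _ L _ d0; have AA0 := @scale_neq0 _ L _ A0.
pose t := y / d%:A.
have t0 : Q2 t = 0%E.
  rewrite ordE ?mulf_neq0 ?invr_eq0 // ordM ?invr_eq0 // ordV // (val_ramified QE) //.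
  rewrite (ord_val Pd); move: (ord_val wU).
  rewrite ordM ?expf_neq0 ?scale_neq0 ?invr_eq0 // ordX //.
  rewrite (val_ramified QE) ?invr_eq0 // ordV // (ord_val PA).
  by move: (ord Q2 y) => n; clear; move=> h; congr (_%:E); lia.
apply: (residue_free2_basis Q2P (t := t)); first by rewrite t0.
move=> c Pc Qtc; apply: (nsq (d * c)).
pose a := A / d ^+ 2.
have Pa : P a = 0%E.
  rewrite /a ordE ?mulf_neq0 ?invr_eq0 ?expf_neq0 // ordM ?invr_eq0 ?expf_neq0 //.
  by rewrite ordV ?expf_neq0 // ordX // (ord_val PA) (ord_val Pd); congr (_%:E); lia.
have -> : A - (d * c) ^+ 2 = d ^+ 2 * (a - c ^+ 2) by rewrite /a; field.
have : (0 < P (a - c ^+ 2)%R)%E.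
  rewrite -(lies_above_gt0 _ Q2P).
  have -> : (a - c ^+ 2)%:A =
      (t - c%:A) * (t + c%:A) - ((A^-1)%:A * y ^+ 2 - 1) * a%:A.
    by rewrite /a /t !algE; field; rewrite AA0 dA0.
  apply: val_sub_gt; apply: val_mul_gt0 => //; last by rewrite (lies_above_ge0 Q2P) ?Pa.
  by apply: val_add_ge; rewrite ?t0 ?(lies_above_ge0 Q2P).
rewrite val_ofM valX // Pd PA.
case: (P _) => [n||] //= h; last by rewrite ltry.
by move: h; rewrite -EFinM -EFinD !lte_fin; lia.
Qed.

(** The valuation of y^3 is that of B by the hypothesis on the values, so that
    three times the valuation of y is n times the ramification index, which is
    therefore divisible by 3. *)
Lemma signature_totally_ramified n : (2%:E * P B < 3%:E * P A)%E ->
  P B = n%:E -> ~ (exists k : int, n = 3 * k) -> signature L P [:: 3; 1]%N.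
Proof.
move=> PAB PB n3; have [Q QP] := exists_place L P.
apply: (@cubic_signature _ _ P dim3 [:: (3, 1)]%N (fun=> Q)) => //.
- by move=> i j _; rewrite (ord1 i) (ord1 j).
- case=> [[|]] // i1 E E0 QE /=.
  have B0 := val_neq0 PB.
  have y0 : y != 0 by apply: contraNneq y1 => ->; rewrite mem0v.
  have QB : Q B%:A = (E%:Z * n)%:E by rewrite QE PB.
  have Qy3 : Q (y ^+ 3) = (3 * ord Q y)%:E by rewrite ordE ?expf_neq0 // ordX.
  have ltBA : (Q (- B%:A)%R < Q (A%:A * y)%R)%E.
    rewrite valN QB; have [A0|A0] := eqVneq A 0.
      by rewrite A0 scale0r mul0r val0 ltry.
    have QA : Q (A%:A * y) = (E%:Z * ord P A + ord Q y)%:E.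
      by rewrite val_ofM QE (ordE _ A0) (ordE _ y0).
    rewrite QA lte_fin ltNge; apply/negP => le.
    have : (Q (A%:A * y)%R <= Q (y ^+ 3)%R)%E.
      by rewrite y3; apply: val_sub_ge; rewrite // QB QA lee_fin.
    rewrite QA Qy3 lee_fin; move: PAB le; rewrite PB (ordE _ A0) -!EFinM lte_fin.
    by move: (ord P A) (ord Q y) => m v; clear -E0; nia.
  have := val_add_lt ltBA; rewrite addrC -y3 Qy3 valN QB => -[h].
  case: E E0 {QE QB ltBA} h => [|[|[|E]]] // _ h; case: n3.
    by exists (ord Q y); rewrite h mul1r.
  by exists (n - ord Q y); move: h; move: (ord Q y) => v; clear; lia.
- by case=> [[|]] // i1; apply: residue_free1.
- by rewrite !big_cons big_nil.
Qed.

(** The residue class of y is a root of a cubic without roots in the residue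
    field of P. *)
Lemma signature_totally_inert : (0 <= P A)%E -> (0 <= P B)%E ->
  (forall c : K, (0 <= P c)%E -> ~ (0 < P (c ^+ 3 - A * c + B)%R)%E) ->
  signature L P [:: 1; 3]%N.
Proof.
move=> PA PB nroot; have [Q QP] := exists_place L P.
have y0 : y != 0 by apply: contraNneq y1 => ->; rewrite mem0v.
have Qy : (0 <= Q y)%E.
  rewrite leNgt; apply/negP => Qy.
  have : (Q y <= Q (y ^+ 3)%R)%E.
    rewrite y3; apply: val_sub_ge; last first.
      exact: le_trans (ltW Qy) (lies_above_ge0 QP PB).
    by rewrite val_ofM -[X in (X <= _)%E]add0e; apply: leeD; rewrite ?(lies_above_ge0 QP PA).
  move: Qy; rewrite !ordE ?expf_neq0 // ordX // lte_fin lee_fin.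
  by move: (ord Q y) => v; clear; lia.
apply: (@cubic_signature _ _ P dim3 [:: (1, 3)]%N (fun=> Q)) => //.
- by move=> i j _; rewrite (ord1 i) (ord1 j).
- by case=> [[|]] // i1 E.
- by case=> [[|]] // i1; apply: (residue_free3_basis QP yrel).
- by rewrite !big_cons big_nil.
Qed.

End CubicCases.

Section Rescaling.
Variables (K : fieldType) (L : fieldExtType K).

Lemma cubic_rescale (A B d : K) (y : L) : d != 0 ->
  y ^+ 3 - A%:A * y + B%:A = 0 ->
  (y / d%:A) ^+ 3 - (A / d ^+ 2)%:A * (y / d%:A) + (B / d ^+ 3)%:A = 0.
Proof.
move=> d0 yrel; have dA0 := @scale_neq0 _ L _ d0.
transitivity ((y ^+ 3 - A%:A * y + B%:A) / d%:A ^+ 3); last by rewrite yrel mul0r.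
by rewrite !algE; field.
Qed.

Lemma rescale_notin1 (d : K) (y : L) : d != 0 ->
  y \notin (1%VS : {vspace L}) -> y / d%:A \notin (1%VS : {vspace L}).
Proof.
move=> d0; have dA0 := @scale_neq0 _ L _ d0; apply: contra => yd.
have -> : y = d *: (y / d%:A) by rewrite -[RHS]mulr_algl mulrCA divff ?mulr1.
exact: rpredZ.
Qed.

(** In characteristic 3 translating the root changes only the constant
    coefficient. *)
Lemma cubic_translate (A B r : K) (y : L) : 3%N \in [pchar K] ->
  y ^+ 3 - A%:A * y + B%:A = 0 ->
  (y - r%:A) ^+ 3 - A%:A * (y - r%:A) + (r ^+ 3 - A * r + B)%:A = 0.
Proof.
move=> char3 yrel; have three : 3%:R = 0 :> L.
  by rewrite -(rmorph_nat (in_alg L)) (pcharf0 char3) rmorph0.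
transitivity ((y ^+ 3 - A%:A * y + B%:A) + 3%:R * (y * r%:A ^+ 2 - y ^+ 2 * r%:A)).
  by rewrite !algE; ring.
by rewrite yrel three mul0r addr0.
Qed.

End Rescaling.

Section SplitSignature.
Variables (K : fieldType) (L : fieldExtType K) (P : place K).

(** Dividing y by c replaces A by A / c^2, which is 1 modulo P. *)
Lemma signature_split (A B c : K) (y : L) : \dim {:L} = 3%N ->
  y \notin (1%VS : {vspace L}) -> y ^+ 3 - A%:A * y + B%:A = 0 ->
  (3%:E * P A < 2%:E * P B)%E -> (P A < P (A - c ^+ 2)%R)%E -> P 2 = 0%E ->
  signature L P [:: 1; 1; 1; 1; 1; 1]%N.
Proof.
move=> dim3 y1 yrel PAB PAc P2.
have A0 : A != 0 by apply: contraTneq PAB => ->; rewrite val0 gt0_muley // -leNgt leey.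
have Pc : P (c ^+ 2) = P A.
  by rewrite -[c ^+ 2](subKr A) val_add_lt // valN.
have c0 : c != 0.
  apply: contra_neq A0 => c0; apply/eqP; rewrite -(val_of_eqy P) -Pc c0 expr0n /=.
  by rewrite val0.
move: Pc; rewrite valX // (ordE _ c0) (ordE _ A0) -EFinM => -[Pc].
have cc0 : c ^+ 2 != 0 by rewrite expf_neq0.
apply: (signature_split_unit dim3 (rescale_notin1 c0 y1) (cubic_rescale c0 yrel)) => //.
  have -> : A / c ^+ 2 - 1 = (A - c ^+ 2) / c ^+ 2 by field.
  move: PAc; rewrite val_ofM valV // ordX // (ordE _ A0).
  by case: (P _) => [n||] //=; rewrite -?EFinD !lte_fin; lia.
have [->|B0] := eqVneq B 0; first by rewrite mul0r val0.
rewrite ordE ?mulf_neq0 ?invr_eq0 ?expf_neq0 // ordM ?invr_eq0 ?expf_neq0 //.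
rewrite ordV ?expf_neq0 // ordX // lte_fin.
move: PAB; rewrite !ordE // -!EFinM lte_fin.
by move: (ord P A) Pc => m <-; lia.
Qed.

End SplitSignature.

(** * The infinite place *)

Section InfinitePlace.
Variable F : fieldType.
Local Notation K := {fraction {poly F}}.
Local Notation P := (P_infty F).
Implicit Types (p : {poly F}) (r : F) (u : K).

Lemma vinf_const r : r != 0 -> P r%:P%:F = 0%E.
Proof.
by move=> r0; rewrite /= vinf_poly degE ?polyC_eq0 // size_polyC r0.
Qed.

Lemma vinf_const_gt0 r : (0 < P r%:P%:F)%E -> r = 0.
Proof. by move=> h; apply/eqP; apply: contraTT h => /vinf_const ->; rewrite ltxx. Qed.

Lemma vinf_const_ge0 r : (0 <= P r%:P%:F)%E.
Proof. by have [->|/vinf_const->//] := eqVneq r 0; rewrite tofrac0 val0 leey. Qed.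

Lemma X_neq0 : 'X%:F != 0 :> K.
Proof. by rewrite tofrac_eq0 polyX_eq0. Qed.

Lemma vinf_Xn n : P ('X%:F ^+ n) = (- n%:Z)%:E.
Proof. by rewrite -tofracXn /= vinf_poly degE ?monic_neq0 ?monicXn // size_polyXn. Qed.

Lemma vinf_small p n : (size p <= n)%N -> ((- n%:Z)%:E < P p%:F)%E.
Proof.
rewrite /= vinf_poly /deg; case: eqP => [_ _|/eqP p0 pn]; first exact: ltry.
by rewrite /= lte_fin ltrN2 ltz_nat prednK // size_poly_gt0.
Qed.

(** The residue class of n / d is the quotient of the coefficients of n and d in
    the degree of d. *)
Lemma vinf_residue u : (0 <= P u)%E -> exists r, (0 < P (u - r%:P%:F)%R)%E.
Proof.
rewrite [u]frac_repr; set d := \d_(repr u); set n := \n_(repr u).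
have d0 : d != 0 := denom_ratioP (repr u).
have dF0 : d%:F != 0 :> K by rewrite tofrac_eq0.
rewrite [P (n%:F / d%:F)]vinf_frac // => nd.
have snd : (size n <= size d)%N.
  have [->|n0] := eqVneq n 0; first by rewrite size_poly0.
  move: nd; rewrite !degE // lee_fin; move: n0 d0; rewrite -!size_poly_gt0.
  by move: (size n) (size d) => i j; clear; lia.
pose r := n`_(size d).-1 / lead_coef d; exists r.
have ld0 : lead_coef d != 0 by rewrite lead_coef_eq0.
have -> : n%:F / d%:F - r%:P%:F = (n - r *: d)%:F / d%:F.
  by rewrite -mul_polyC tofracB tofracM mulrBl mulfK.
rewrite val_div_gt0 // [P d%:F]vinf_poly degE //.
have : (size (n - r *: d)%R <= (size d).-1)%N.
  apply/leq_sizeP => j; rewrite leq_eqVlt => /orP[/eqP<-|jd].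
    by rewrite coefB coefZ -/(lead_coef d) /r divfK // subrr.
  have jd' : (size d <= j)%N by rewrite -[size d]prednK // size_poly_gt0.
  by rewrite coefB coefZ !nth_default ?mulr0 ?subr0 // (leq_trans snd).
exact: vinf_small.
Qed.

Lemma vinf_lead p n : size p = n.+1 ->
  (0 < P (p%:F / 'X%:F ^+ n - (lead_coef p)%:P%:F)%R)%E.
Proof.
move=> sp; have X0 := X_neq0.
have -> : p%:F / 'X%:F ^+ n - (lead_coef p)%:P%:F =
    (p - lead_coef p *: 'X^n)%:F / 'X%:F ^+ n :> K.
  by rewrite -mul_polyC tofracB tofracM tofracXn mulrBl mulfK ?expf_neq0.
have : (size (p - lead_coef p *: 'X^n)%R <= n)%N.
  apply/leq_sizeP => j; rewrite leq_eqVlt => /orP[/eqP<-|jn].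
    by rewrite coefB coefZ coefXn eqxx mulr1 lead_coefE sp subrr.
  rewrite coefB coefZ coefXn eq_sym (ltn_eqF jn) mulr0 subr0.
  by rewrite nth_default // sp.
by rewrite val_div_gt0 ?expf_neq0 // vinf_Xn; apply: vinf_small.
Qed.

Lemma deg_size p (n : int) : deg p = n%:E -> exists2 m, n = m%:Z & size p = m.+1.
Proof.
rewrite /deg; case: eqP => // /eqP p0 [<-]; exists (size p).-1 => //.
by rewrite prednK // size_poly_gt0.
Qed.

Lemma vinf_double p k : size p = (2 * k).+1 -> P p%:F = (2 * (- k%:Z))%:E.
Proof.
move=> sp; rewrite /= vinf_poly degE; last by rewrite -size_poly_gt0 sp.
by rewrite sp; congr (_%:E); lia.
Qed.

Lemma vinf_square_approx p k c : size p = (2 * k).+1 -> lead_coef p = c ^+ 2 ->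
  (P p%:F < P (p%:F - (c%:P%:F * 'X%:F ^+ k) ^+ 2)%R)%E.
Proof.
move=> sp pc; have Xn0 : 'X%:F ^+ (2 * k) != 0 :> K by rewrite expf_neq0 ?X_neq0.
have := vinf_lead sp.
have -> : p%:F / 'X%:F ^+ (2 * k) - (lead_coef p)%:P%:F =
   (p%:F - (c%:P%:F * 'X%:F ^+ k) ^+ 2) / 'X%:F ^+ (2 * k) :> K.
  by rewrite pc polyC_exp tofracXn mulrBl exprMn -exprM [(k * 2)%N]mulnC mulfK.
rewrite val_div_gt0 // vinf_Xn; apply: le_lt_trans.
by rewrite (vinf_double sp) lee_fin; lia.
Qed.

(** As residue classes are constants, an approximate square root of p yields a
    square root of its leading coefficient. *)
Lemma vinf_square_lead p k u : size p = (2 * k).+1 ->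
  (P p%:F < P (p%:F - u ^+ 2)%R)%E -> exists c, lead_coef p = c ^+ 2.
Proof.
move=> sp pu; have X0 := X_neq0.
have Xn0 : 'X%:F ^+ (2 * k) != 0 :> K := expf_neq0 _ X0.
pose w := u / 'X%:F ^+ k.
have pw : (0 < P (p%:F / 'X%:F ^+ (2 * k) - w ^+ 2)%R)%E.
  have -> : p%:F / 'X%:F ^+ (2 * k) - w ^+ 2 =
      (p%:F - u ^+ 2) / 'X%:F ^+ (2 * k) :> K.
    by rewrite /w mulrBl expr_div_n -exprM mulnC.
  rewrite (val_div_gt0 _ _ Xn0); apply: le_lt_trans pu.
  by rewrite vinf_Xn (vinf_double sp) lee_fin; lia.
have w0 : (0 <= P w)%E.
  have [->|w0] := eqVneq w 0; first by rewrite val0 leey.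
  have : (0 <= P (w ^+ 2)%R)%E.
    rewrite -[w ^+ 2](subKr (p%:F / 'X%:F ^+ (2 * k))).
    apply: val_sub_ge; last exact: ltW.
    by rewrite (val_div_ge0 _ _ Xn0) vinf_Xn (vinf_double sp) lee_fin; lia.
  by rewrite !ordE ?expf_neq0 // ordX // !lee_fin; lia.
have [c wc] := vinf_residue w0; exists c.
apply/eqP; rewrite -subr_eq0; apply/eqP/vinf_const_gt0.
have telescope (R : comNzRingType) (x z a b : R) :
  a - b ^+ 2 = x - z ^+ 2 + (z - b) * (z + b) - (x - a) by ring.
have -> : (lead_coef p - c ^+ 2)%:P%:F =
   (p%:F / 'X%:F ^+ (2 * k) - w ^+ 2) + (w - c%:P%:F) * (w + c%:P%:F)
   - (p%:F / 'X%:F ^+ (2 * k) - (lead_coef p)%:P%:F) :> K.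
  by rewrite polyCB tofracB polyC_exp tofracXn; apply: telescope.
apply: val_sub_gt; last exact: vinf_lead.
apply: val_add_gt => //; apply: val_mul_gt0 => //.
by apply: val_add_ge => //; apply: vinf_const_ge0.
Qed.

End InfinitePlace.

Section CubicResidues.
Variable F : fieldType.
Local Notation K := {fraction {poly F}}.
Local Notation P := (P_infty F).
Implicit Types (A B : {poly F}) (a b c r : F).

Lemma root_cubic a b r : root (cubic a b) r = (r ^+ 3 - a * r + b == 0).
Proof. by rewrite /root /cubic !hornerE. Qed.

(** Two roots differ by a square root of a, by additivity of cubing. *)
Lemma cubic_roots_square a b r s : 3%N \in [pchar F] -> r != s ->
  root (cubic a b) r -> root (cubic a b) s -> a = (r - s) ^+ 2.
Proof.
move=> char3 rs; rewrite !root_cubic => /eqP r0 /eqP s0.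
have rs0 : r - s != 0 by rewrite subr_eq0.
have three : 3%:R = 0 :> F := pcharf0 char3.
apply: (mulfI rs0); apply/eqP; rewrite eq_sym -subr_eq0; apply/eqP.
transitivity ((r ^+ 3 - a * r + b) - (s ^+ 3 - a * s + b)
    + 3%:R * (r * s ^+ 2 - r ^+ 2 * s)); first by ring.
by rewrite r0 s0 three mul0r subrr addr0.
Qed.

Lemma cubic_square_root a b c r : 3%N \in [pchar F] -> a = c ^+ 2 ->
  root (cubic a b) r -> root (cubic a b) (r + c).
Proof.
move=> char3 ->; rewrite !root_cubic => /eqP r0; apply/eqP.
have three : 3%:R = 0 :> F := pcharf0 char3.
transitivity ((r ^+ 3 - c ^+ 2 * r + b) + 3%:R * (r ^+ 2 * c + r * c ^+ 2)).
  by ring.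
by rewrite r0 three mul0r addr0.
Qed.

Lemma vinf_cubic_residue A B k (w : K) r :
  size A = (2 * k).+1 -> size B = (3 * k).+1 -> (0 < P (w - r%:P%:F)%R)%E ->
  (0 < P (w ^+ 3 - A%:F / 'X%:F ^+ k ^+ 2 * w + B%:F / 'X%:F ^+ k ^+ 3
          - (r ^+ 3 - lead_coef A * r + lead_coef B)%:P%:F)%R)%E.
Proof.
move=> sA sB wr; have hA := vinf_lead sA; have hB := vinf_lead sB.
have w0 : (0 <= P w)%E.
  rewrite -(subrK r%:P%:F w); apply: val_add_ge; first exact: ltW.
  exact: vinf_const_ge0.
rewrite -!exprM ![(k * _)%N]mulnC.
have expand (R : comNzRingType) (x z t a b s : R) :
    x ^+ 3 - z * x + t - (s ^+ 3 - a * s + b) =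
    (x - s) * (x ^+ 2 + x * s + s ^+ 2 - a) - (z - a) * x + (t - b) by ring.
set al := A%:F / _ in hA *; set be := B%:F / _ in hB *.
have -> : w ^+ 3 - al * w + be - (r ^+ 3 - lead_coef A * r + lead_coef B)%:P%:F =
  (w - r%:P%:F) * (w ^+ 2 + w * r%:P%:F + r%:P%:F ^+ 2 - (lead_coef A)%:P%:F)
  - (al - (lead_coef A)%:P%:F) * w + (be - (lead_coef B)%:P%:F).
  by rewrite !(polyCB, polyCD, polyCM, polyC_exp, tofracB, tofracD, tofracM, tofracXn);
    apply: expand.
have cge c : (0 <= P c%:P%:F)%E := vinf_const_ge0 c.
apply: val_add_gt => //; apply: val_sub_gt; last exact: val_mul_gt0.
apply: val_mul_gt0 => //; apply: val_sub_ge => //.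
by do ![apply: val_add_ge]; rewrite ?expr2 val_mul_ge0.
Qed.

Lemma vinf_scaled_lt A B (m n : int) :
  (m%:E * deg A < n%:E * deg B)%E -> (n%:E * P B%:F < m%:E * P A%:F)%E.
Proof. by rewrite /= !vinf_poly !muleN lteN2. Qed.

Lemma deg_proportional A B : (A != 0) || (B != 0) ->
  (3%:E * deg A = 2%:E * deg B)%E ->
  exists2 k, size A = (2 * k).+1 & size B = (3 * k).+1.
Proof.
have [->|A0] := eqVneq A 0.
  by move=> /= B0; rewrite [deg B]degE // /deg eqxx.
move=> _; rewrite (degE A0); have [->|B0] := eqVneq B 0; first by rewrite /deg eqxx.
rewrite (degE B0) -!EFinM; move: A0 B0; rewrite -!size_poly_gt0.
move: (size A) (size B) => i j; clear; move=> i0 j0 [h].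
by exists (j.-1 - i.-1)%N; lia.
Qed.

End CubicResidues.

Lemma standard_form_dim (F : finFieldType) (L : fieldExtType {fraction {poly F}})
    (A B : {poly F}) (y : L) : standard_form A B y ->
  \dim {:L} = 3%N /\ y \notin (1%VS : {vspace L}).
Proof.
move=> [irr yrel gen _ _ _].
have size_cubic : size (cubic A%:F B%:F) = 4%N.
  rewrite /cubic -addrA size_polyDl size_polyXn // ltnS.
  apply: leq_trans (size_polyD _ _) _; rewrite geq_max size_polyN.
  rewrite (leq_trans (size_scale_leq _ _)) ?size_polyX //.
  by rewrite (leq_trans (size_polyC_leq1 _)).
have /polyOver1P[q qE] := minPolyOver 1%AS y.
have deg_q : size q = (\dim {:L}).+1.
  rewrite -(size_map_poly (in_alg L)) -qE size_minPoly adjoin_degreeE.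
  by rewrite dimv1 divn1 gen.
have dim0 : (0 < \dim {:L})%N by rewrite adim_gt0.
have qdvd : q %| cubic A%:F B%:F.
  rewrite -(dvdp_map (in_alg L)) -qE; apply: minPoly_dvdp.
    by apply/polyOver1P; exists (cubic A%:F B%:F).
  rewrite /root /cubic rmorphD rmorphB /= map_polyXn map_polyZ /= map_polyX map_polyC /=.
  by rewrite !hornerE yrel.
have sq1 : size q != 1%N by rewrite deg_q eqSS -lt0n.
have /eqp_size := apply_irredp irr sq1 qdvd.
rewrite size_cubic deg_q => -[dim3]; split=> //.
apply/negP; rewrite -adjoin_deg_eq1 adjoin_degreeE dimv1 divn1 gen.
by move=> /eqP; rewrite dim3.
Qed.

(** A root r of T^3 - a T + b is moved to 0 by translating y by r x^k. This
    makes the constant coefficient negligible, so that the case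
    3 deg A = 2 deg B with a root falls under the case 3 deg A > 2 deg B. *)
Lemma cubic_depress (F : fieldType) (L : fieldExtType {fraction {poly F}})
    (A B : {poly F}) (y : L) r : 3%N \in [pchar F] ->
  y \notin (1%VS : {vspace L}) -> y ^+ 3 - A%:F%:A * y + B%:F%:A = 0 ->
  (3%:E * deg A = 2%:E * deg B)%E -> (A != 0) || (B != 0) ->
  root (cubic (lead_coef A) (lead_coef B)) r ->
  exists (y' : L) (b : {fraction {poly F}}),
    [/\ y' \notin (1%VS : {vspace L}), y' ^+ 3 - A%:F%:A * y' + b%:A = 0
      & (3%:E * P_infty F A%:F < 2%:E * P_infty F b)%E].
Proof.
move=> char3 y1 yrel degE AB0 rootr.
have [k sA sB] := deg_proportional AB0 degE.
pose x : {fraction {poly F}} := 'X%:F ^+ k; pose t := r%:P%:F * x.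
have x0 : x != 0 := expf_neq0 _ (X_neq0 F).
have charK : 3%N \in [pchar {fraction {poly F}}].
  by rewrite (rmorph_pchar (@tofrac _)) // (rmorph_pchar (@polyC F)).
exists (y - t%:A), (t ^+ 3 - A%:F * t + B%:F); split.
- apply: contra y1 => y1; rewrite -(subrK t%:A y); apply: rpredD => //.
  exact: alg_in1.
- exact: cubic_translate.
have := @vinf_cubic_residue F A B k r%:P%:F r sA sB.
rewrite subrr val0 => /(_ isT); move: rootr; rewrite root_cubic => /eqP ->.
rewrite subr0 -/x.
have scale (E : fieldType) (u v w z : E) : z != 0 ->
    w ^+ 3 - u / z ^+ 2 * w + v / z ^+ 3 = ((w * z) ^+ 3 - u * (w * z) + v) / z ^+ 3.
  by move=> z0; field.
rewrite (scale _ A%:F B%:F r%:P%:F x x0) -/t (val_div_gt0 _ _ (expf_neq0 3 x0)).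
rewrite /x -exprM vinf_Xn (vinf_double sA); move: (P_infty F _) => n.
by case: n => [m||] //=; rewrite -?EFinM ?gt0_muley ?ltry // !lte_fin; lia.
Qed.

Theorem theorem2p1p6
    (F : finFieldType) (charF : 3%N \in [pchar F])
    (L : fieldExtType {fraction {poly F}})
    (A B : {poly F}) (y : L) (sf : standard_form A B y) :
  let n1 : \bar int := deg A in
  let n0 : \bar int := deg B in
  let a : F := lead_coef A in
  let b : F := lead_coef B in
  let nroots : nat := #|[set t : F | root (cubic a b) t]| in
  let sig : seq nat -> Prop := signature L (P_infty F) in
  [/\ ((2 * n0 < 3 * n1)%E /\ (exists k : int, n1 = (2 * k)%:E) /\
         (exists c : F, a = c ^+ 2)) \/
      ((3 * n1 = 2 * n0)%E /\ nroots = 3%N) ->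
      sig [:: 1; 1; 1; 1; 1; 1]%N,
      (2 * n0 < 3 * n1)%E /\ (exists k : int, n1 = (2 * k + 1)%:E) ->
      sig [:: 1; 1; 2; 1]%N,
      ((2 * n0 < 3 * n1)%E /\ (exists k : int, n1 = (2 * k)%:E) /\
         ~ (exists c : F, a = c ^+ 2)) \/
      ((3 * n1 = 2 * n0)%E /\ nroots = 1%N) ->
      sig [:: 1; 1; 1; 2]%N,
      (3 * n1 < 2 * n0)%E /\ ~ (exists k : int, n0 = (3 * k)%:E) ->
      sig [:: 3; 1]%N
    & (3 * n1 = 2 * n0)%E /\ nroots = 0%N ->
      sig [:: 1; 3]%N].
Proof.
move=> n1 n0 a b nroots sig.
have [dim3 y1] := standard_form_dim sf; have yrel := sf_root sf.
have y0 : y != 0 by apply: contraNneq y1 => ->; rewrite mem0v.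
have AB0 : (A != 0) || (B != 0).
  apply: contraR y0; rewrite negb_or !negbK => /andP[/eqP A0 /eqP B0].
  move: yrel; rewrite A0 B0 tofrac0 !scale0r mul0r subr0 addr0 => /eqP.
  by rewrite expf_eq0.
pose depressed := exists (y' : L) b',
    [/\ y' \notin (1%VS : {vspace L}), y' ^+ 3 - A%:F%:A * y' + b'%:A = 0
      & (3%:E * P_infty F A%:F < 2%:E * P_infty F b')%E].
have three : 3%:R = 0 :> F := pcharf0 charF.
have P2 : P_infty F 2 = 0%E.
  have -> : 2 = - 1 :> {fraction {poly F}}.
    apply/eqP; rewrite -subr_eq0 opprK natr1.
    rewrite -(rmorph_nat (@tofrac _)) -(rmorph_nat (@polyC F)) three.
    by rewrite !rmorph0.
  exact: valN1.
have even k : n1 = (2 * k)%:E -> exists m : nat, size A = (2 * m).+1.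
  move=> /deg_size[n kn sA]; exists (absz k); rewrite sA; congr _.+1; lia.
have A0lt : (2 * n0 < 3 * n1)%E -> (3%:E * P_infty F A%:F < 2%:E * P_infty F B%:F)%E.
  exact: vinf_scaled_lt.
have finroot r : root (cubic a b) r -> (3 * n1 = 2 * n0)%E ->
   [/\ exists m : nat, size A = (2 * m).+1 & depressed].
  move=> rr n10; split; last exact: (cubic_depress charF y1 yrel n10 AB0 rr).
  by have [m sA _] := deg_proportional AB0 n10; exists m.
have exroot : (0 < nroots)%N -> exists r, root (cubic a b) r.
  by move=> /card_gt0P[r]; rewrite inE; exists r.
split.
- move=> case1; suff [[m sA] [c ac] [y' [b' [y'1 y'rel PAb]]]] :
      [/\ exists m : nat, size A = (2 * m).+1, exists c : F, a = c ^+ 2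
        & depressed].
    exact: (signature_split dim3 y'1 y'rel PAb (vinf_square_approx sA ac) P2).
  case: case1 => [[lt [[k nk] sq]]|[n10 nr]].
    by split=> //; [exact: even nk|exists y, B%:F; split=> //; apply: A0lt].
  have [r rr] : exists r, root (cubic a b) r by apply: exroot; rewrite nr.
  have [sA y'P] := finroot r rr n10; split=> //.
  have /card_gt1P[s [t [rs rt st]]] : (1 < nroots)%N by rewrite nr.
  by exists (s - t); rewrite !inE in rs rt; apply: cubic_roots_square rs rt.
- move=> [lt [k nk]]; have [n kn sA] := deg_size nk.
  apply: (signature_ramified dim3 y1 yrel (A0lt lt) (k := - k - 1)).
  rewrite /= vinf_poly -/n1 nk; congr (_%:E); lia.
- move=> case3; suff [[m sA] nsq [y' [b' [y'1 y'rel PAb]]]] :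
      [/\ exists m : nat, size A = (2 * m).+1, ~ exists c : F, a = c ^+ 2
        & depressed].
    apply: (signature_inert dim3 y'1 y'rel PAb (vinf_double sA)) => c hc.
    exact/nsq/(vinf_square_lead sA hc).
  case: case3 => [[lt [[k nk] sq]]|[n10 nr]].
    by split=> //; [exact: even nk|exists y, B%:F; split=> //; apply: A0lt].
  have [r rr] : exists r, root (cubic a b) r by apply: exroot; rewrite nr.
  have [[m sA] y'P] := finroot r rr n10; split=> //; first by exists m.
  move=> [c ac]; have : (1 < nroots)%N; last by rewrite nr.
  apply/card_gt1P; exists r, (r + c); rewrite !inE; split=> //.
    exact: cubic_square_root ac rr.
  apply/eqP => rc; have c0 : c = 0 by apply: (addrI r); rewrite -rc addr0.
  have : a == 0 by rewrite ac c0 expr0n.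
  by rewrite lead_coef_eq0 -size_poly_eq0 sA.
- move=> [lt n3]; have B0 : B != 0.
    apply: contraTneq lt => B0; rewrite /n0 B0 /deg eqxx gt0_muleNy ?lte_fin //.
    by rewrite -leNgt leNye.
  apply: (signature_totally_ramified dim3 y1 yrel (n := - (size B).-1%:Z)).
  + exact: vinf_scaled_lt.
  + by rewrite /= vinf_poly degE.
  + move=> [k kE]; apply: n3; exists (- k); rewrite /n0 degE //.
    by congr (_%:E); move: (size B).-1 kE => j; clear; lia.
- move=> [n10 nr]; have [k sA sB] := deg_proportional AB0 n10.
  pose x : {fraction {poly F}} := 'X%:F ^+ k.
  have x0 : x != 0 := expf_neq0 _ (X_neq0 F).
  apply: (signature_totally_inert dim3 (rescale_notin1 x0 y1) (cubic_rescale x0 yrel)).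
  + rewrite (val_div_ge0 _ _ (expf_neq0 2 x0)) (vinf_double sA) /x -exprM vinf_Xn.
    by rewrite lee_fin; lia.
  + rewrite (val_div_ge0 _ _ (expf_neq0 3 x0)) /x -exprM vinf_Xn /= vinf_poly degE.
      by rewrite sB lee_fin; lia.
    by rewrite -size_poly_gt0 sB.
  move=> c c0 Pc; have [r cr] := vinf_residue c0.
  have := vinf_cubic_residue sA sB cr; rewrite -/a -/b -/x => Pcr.
  have /vinf_const_gt0 r0 : (0 < P_infty F (r ^+ 3 - a * r + b)%:P%:F)%E.
    by have := val_sub_gt Pc Pcr; rewrite subKr.
  have : r \in [set t : F | root (cubic a b) t] by rewrite inE root_cubic r0.
  by move: nr => /eqP; rewrite cards_eq0 => /eqP ->; rewrite inE.
Qed.
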